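(* Every pseudocompact C$^*$-algebra $A$ has the Dixmier property: for every $a\in A$, $\overline{\mathrm{conv}}\{uau^*: u\in\mathcal{U}(A)\}\cap Z(A)\neq\emptyset$, where the closure is in norm.
   Context: $\mathcal{U}(A)$ is the unitary group of $A$ and $Z(A)$ its center. $M_n$ denotes the C$^*$-algebra of complex $n\times n$ matrices, $n\ge 1$. Finite-dimensional C$^*$-algebras are, up to isomorphism, the (nonempty) finite direct sums of matrix algebras $M_n$. Continuous logic for C$^*$-algebras: atomic formulae are norms $\|P(x_1,\dots,x_k)\|$ of $*$-polynomials with complex coefficients (a constant $I$ for the identity may be used when the algebras are unital); formulae are built from these by applying continuous real-valued functions to finitely many formulae and by taking $\sup$ or $\inf$ of a variable over the closed unit ball. A sentence is a formula without free variables; $\varphi^A\in\mathbb{R}$ is its value in $A$. $A\equiv B$ (elementarily equivalent) if $\varphi^A=\varphi^B$ for every sentence $\varphi$. For an ultrafilter $\mathcal{V}$ on a set $J$, the ultraproduct $\prod_{\mathcal{V}}A_i$ is the C$^*$-algebra of bounded families $(a_i)_{i\in J}$ modulo those with $\lim_{\mathcal{V}}\|a_i\|=0$. A C$^*$-algebra is pseudocompact if it is elementarily equivalent to an ultraproduct of finite-dimensional C$^*$-algebras. Pseudocompact C$^*$-algebras are unital. *)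

(* Defs.v *)
From HB Require Import structures.
From mathcomp Require Import all_boot all_order all_algebra.
From mathcomp Require Import all_classical all_reals all_analysis.
From mathcomp Require Import complex lra.

Set Implicit Arguments.
Unset Strict Implicit.
Unset Printing Implicit Defensive.

Import Order.TTheory GRing.Theory Num.Theory.
Import numFieldNormedType.Exports.
Import ComplexField.

Local Open Scope classical_set_scope.
Local Open Scope ring_scope.
Local Open Scope complex_scope.

Definition norm_complete (R : realType) (V : zmodType) (N : V -> R) : Prop :=
  forall u : nat -> V,
    (forall e, 0 < e -> exists n0 : nat,
       forall m n, (n0 <= m)%N -> (n0 <= n)%N -> N (u m - u n) < e) ->
    exists l, forall e, 0 < e -> exists n0 : nat,
      forall n, (n0 <= n)%N -> N (u n - l) < e.

(* Unital C*-algebras, nonzero because 1 != 0 in an algType.  The norm is a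
   field, with values in R: the hierarchy has no common instance of the algebra
   and normed-module structures over R[i], and the norm of the latter would
   take its values in R[i]. *)
HB.mixin Record isCStarAlgebra (R : realType) A & GRing.Algebra R[i] A := {
  star : A -> A ;
  starD : forall x y : A, star (x + y) = star x + star y ;
  starZ : forall (c : R[i]) (x : A), star (c *: x) = c^* *: star x ;
  starM : forall x y : A, star (x * y) = star y * star x ;
  starK : forall x : A, star (star x) = x ;
  cnorm : A -> R ;
  cnormD : forall x y : A, cnorm (x + y) <= cnorm x + cnorm y ;
  cnormZ : forall (c : R[i]) (x : A),
    cnorm (c *: x) = Normc.normc c * cnorm x ;
  cnorm0_eq0 : forall x : A, cnorm x = 0 -> x = 0 ;
  cnormM : forall x y : A, cnorm (x * y) <= cnorm x * cnorm y ;
  cnorm_star_mul : forall x : A, cnorm (star x * x) = cnorm x ^+ 2 ;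
  cnorm_complete : norm_complete cnorm
}.

#[short(type="cstarType")]
HB.structure Definition CStarAlgebra (R : realType) :=
  {A of isCStarAlgebra R A & GRing.Algebra R[i] A}.

Section CStarTheory.
Context {R : realType} {A : cstarType R}.
Implicit Types x y z : A.

Lemma cnorm0 : cnorm (0 : A) = 0.
Proof. by rewrite -(scale0r (0 : A)) cnormZ Normc.normc0 mul0r. Qed.

Lemma cnormN x : cnorm (- x) = cnorm x.
Proof. by rewrite -scaleN1r cnormZ normcN Normc.normc1 mul1r. Qed.

Lemma cnormB x y : cnorm (x - y) = cnorm (y - x).
Proof. by rewrite -cnormN opprB. Qed.

Lemma cnorm_ge0 x : 0 <= cnorm x.
Proof.
have := cnormD x (- x); rewrite subrr cnorm0 cnormN -mulr2n.
by rewrite pmulrn_lge0.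
Qed.

Lemma cnorm_dist x y : `|cnorm x - cnorm y| <= cnorm (x - y).
Proof.
rewrite ler_norml; apply/andP; split.
  by rewrite lerNl opprB lerBlDr cnormB -{1}(subrK x y) cnormD.
by rewrite lerBlDr -{1}(subrK y x) cnormD.
Qed.

Lemma star0 : star (0 : A) = 0.
Proof. by apply: (addrI (star (0 : A))); rewrite -starD !addr0. Qed.

Lemma starN x : star (- x) = - star x.
Proof. by apply: (addrI (star x)); rewrite -starD !subrr star0. Qed.

Lemma star1 : star (1 : A) = 1.
Proof. by rewrite -[LHS]mul1r -{1}(starK (1 : A)) -starM mul1r starK. Qed.

Lemma cnorm_star x : cnorm (star x) = cnorm x.
Proof.
have le y : cnorm y <= cnorm (star y) :> R.
  have [->|y0] := eqVneq (cnorm y) 0; first exact: cnorm_ge0.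
  have yp : 0 < cnorm y by rewrite lt_def y0 cnorm_ge0.
  by rewrite -(ler_pM2r yp) -expr2 -cnorm_star_mul cnormM.
by apply/eqP; rewrite eq_le le -{2}(starK x) le.
Qed.

Lemma cnorm1 : cnorm (1 : A) = 1.
Proof.
have n0 : cnorm (1 : A) != 0.
  by apply/eqP => /cnorm0_eq0 /eqP; rewrite oner_eq0.
have := cnorm_star_mul (1 : A); rewrite star1 mulr1 expr2 => h.
by apply: (mulfI n0); rewrite mulr1 -h.
Qed.

End CStarTheory.

Section UltraproductDef.
Context {R : realType} {J : Type} (V : set_system J) (F : J -> cstarType R).

Record bfam := BFam {
  bfam_fun :> forall j, F j ;
  bfamP : exists M : R, forall j, cnorm (bfam_fun j) <= M }.

HB.instance Definition _ := gen_eqMixin bfam.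
HB.instance Definition _ := gen_choiceMixin bfam.

Lemma bfam_eq (f g : bfam) : (forall j, f j = g j) -> f = g.
Proof.
case: f g => f fP [g gP] /= fg.
have {}fg : f = g by apply: functional_extensionality_dep.
by subst g; congr BFam; apply: Prop_irrelevance.
Qed.


Definition bfam_eqv (f g : bfam) : Prop :=
  (fun j => cnorm (f j - g j)) @ V --> (0 : R).

Lemma bfam_bound (f : bfam) :
  exists2 M : R, 0 <= M & forall j, cnorm (f j) <= M.
Proof.
have [M fM] := bfamP f; exists (Num.max 0 M) => [|j]; first by rewrite le_max lexx.
by rewrite le_max fM orbT.
Qed.

Fact bfam0_subproof : exists M : R, forall j, cnorm (0 : F j) <= M.
Proof. by exists 0 => j; rewrite cnorm0. Qed.
Definition bfam0 := BFam bfam0_subproof.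

Fact bfam1_subproof : exists M : R, forall j, cnorm (1 : F j) <= M.
Proof. by exists 1 => j; rewrite cnorm1. Qed.
Definition bfam1 := BFam bfam1_subproof.

Fact bfamN_subproof (f : bfam) : exists M : R, forall j, cnorm (- f j) <= M.
Proof. by have [M _ fM] := bfam_bound f; exists M => j; rewrite cnormN. Qed.
Definition bfamN f := BFam (bfamN_subproof f).

Fact bfamD_subproof (f g : bfam) :
  exists M : R, forall j, cnorm (f j + g j) <= M.
Proof.
have [M _ fM] := bfam_bound f; have [N _ gN] := bfam_bound g.
by exists (M + N) => j; rewrite (le_trans (cnormD _ _))// lerD.
Qed.
Definition bfamD f g := BFam (bfamD_subproof f g).

Fact bfamM_subproof (f g : bfam) :
  exists M : R, forall j, cnorm (f j * g j) <= M.
Proof.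
have [M _ fM] := bfam_bound f; have [N _ gN] := bfam_bound g.
by exists (M * N) => j; rewrite (le_trans (cnormM _ _))// ler_pM// cnorm_ge0.
Qed.
Definition bfamM f g := BFam (bfamM_subproof f g).

Fact bfamZ_subproof (c : R[i]) (f : bfam) :
  exists M : R, forall j, cnorm (c *: f j) <= M.
Proof.
have [M _ fM] := bfam_bound f; exists (Normc.normc c * M) => j.
by rewrite cnormZ ler_wpM2l//; case: c => a b; exact: sqrtr_ge0.
Qed.
Definition bfamZ c f := BFam (bfamZ_subproof c f).

Fact bfam_star_subproof (f : bfam) :
  exists M : R, forall j, cnorm (star (f j)) <= M.
Proof. by have [M _ fM] := bfam_bound f; exists M => j; rewrite cnorm_star. Qed.
Definition bfam_star f := BFam (bfam_star_subproof f).

Context (UV : UltraFilter V).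

Lemma bfam_eqvP (f g : bfam) : bfam_eqv f g <->
  forall e, 0 < e -> \forall j \near V, cnorm (f j - g j) < e.
Proof.
split=> [/cvgr0Pnorm_lt h e e0|h].
  by have := h _ e0; apply: filterS => j; rewrite ger0_norm ?cnorm_ge0.
apply/cvgr0Pnorm_lt => e e0; have := h _ e0.
by apply: filterS => j; rewrite ger0_norm ?cnorm_ge0.
Qed.

Lemma bfam_eqv_le (f g : bfam) (b : J -> R) :
  b @ V --> (0 : R) -> (forall j, cnorm (f j - g j) <= b j) -> bfam_eqv f g.
Proof.
move=> /cvgr0Pnorm_lt h0 fgh; apply/bfam_eqvP => e e0.
have := h0 _ e0; apply: filterS => j; apply: le_lt_trans.
by rewrite (le_trans (fgh j))// ler_norm.
Qed.

Let cvg0D (a b : J -> R) : a @ V --> (0 : R) -> b @ V --> (0 : R) ->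
  (fun j => a j + b j) @ V --> (0 : R).
Proof. by move=> a0 b0; rewrite -[0]addr0; apply: cvgD. Qed.

Let cvg0Z (c : R) (a : J -> R) :
  a @ V --> (0 : R) -> (fun j => c * a j) @ V --> (0 : R).
Proof. by move=> a0; rewrite -(mulr0 c); apply: cvgMr. Qed.

Lemma bfam_eqv_refl f : bfam_eqv f f.
Proof.
apply: (@bfam_eqv_le _ _ (fun=> 0)); first exact: cvg_cst.
by move=> j; rewrite subrr cnorm0.
Qed.

Lemma bfam_eqv_sym f g : bfam_eqv f g -> bfam_eqv g f.
Proof. by move=> fg; apply: (bfam_eqv_le fg) => j; rewrite cnormB. Qed.

Lemma bfam_eqv_trans g f h : bfam_eqv f g -> bfam_eqv g h -> bfam_eqv f h.
Proof.
move=> fg gh; have fgh := cvg0D fg gh.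
apply: (bfam_eqv_le fgh) => j /=.
by rewrite -(subrKA (g j)) cnormD.
Qed.

Definition bfam_eqvb : rel bfam := fun f g => `[< bfam_eqv f g >].

Fact bfam_eqvb_equiv : equiv_class_of bfam_eqvb.
Proof.
split=> [f|f g|g f h]; first exact/asboolP/bfam_eqv_refl.
  by apply/asboolP/asboolP; exact: bfam_eqv_sym.
by move=> /asboolP fg /asboolP gh; exact/asboolP/(bfam_eqv_trans fg).
Qed.
Canonical bfam_eqvb_equivrel := EquivRelPack bfam_eqvb_equiv.

Local Open Scope quotient_scope.

Definition ultraproduct : Type := {eq_quot bfam_eqvb}.
HB.instance Definition _ := Choice.on ultraproduct.
HB.instance Definition _ := EqQuotient.on ultraproduct.

Definition upi (f : bfam) : ultraproduct := \pi_ultraproduct f.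

Lemma upiP f g : upi f = upi g <-> bfam_eqv f g.
Proof. by split=> [/eqmodP/asboolP|h] //; apply/eqmodP/asboolP. Qed.

Lemma upi_surj (x : ultraproduct) : exists f, x = upi f.
Proof. by exists (repr x); rewrite /upi reprK. Qed.

Lemma repr_upi f : bfam_eqv (repr (upi f)) f.
Proof. by apply/upiP; rewrite /upi reprK. Qed.


Definition ucnorm (x : ultraproduct) : R := lim ((fun j => cnorm (repr x j)) @ V).

Lemma fmap_ultra (h : J -> R) : UltraFilter (h @ V).
Proof.
split=> [|G GP hG]; first exact: fmap_proper_filter.
rewrite eqEsubset; split=> // A GA.
have [//|VnA] := in_ultra_setVsetC (h @^-1` A) UV.
have : G (A `&` ~` A) by apply: filterI => //; exact: hG.
by rewrite setICr => /filter_not_empty.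
Qed.

Lemma bfam_cvg (f : bfam) : cvg ((fun j => cnorm (f j)) @ V).
Proof.
have [M M0 fM] := bfam_bound f.
have := @segment_compact R 0 M; rewrite compact_ultra.
move=> /(_ _ (fmap_ultra (fun j => cnorm (f j)))).
case=> [|l [_ fl]]; last by apply/cvg_ex; exists l; exact: fl.
apply: (@filterE _ V) => j /=.
by rewrite in_itv/= cnorm_ge0 fM.
Qed.

Lemma ucnorm_cvg (f : bfam) : (fun j => cnorm (f j)) @ V --> ucnorm (upi f).
Proof.
have rf : (fun j => cnorm (repr (upi f) j - f j)) @ V --> (0 : R).
  exact: repr_upi.
have h : (fun j => cnorm (repr (upi f) j)) @ V --> ucnorm (upi f).
  exact: bfam_cvg.
apply/cvgrPdist_lt => e e0.
have e2 : 0 < e / 2 by rewrite divr_gt0.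
have h1 : \forall j \near V, `|ucnorm (upi f) - cnorm (repr (upi f) j)| < e / 2.
  by move/cvgrPdist_lt : h; exact.
have h2 : \forall j \near V, `|cnorm (repr (upi f) j - f j)| < e / 2.
  by move/cvgr0Pnorm_lt : rf; exact.
apply: filterS2 h1 h2 => j h1 h2; rewrite (splitr e).
rewrite -(subrKA (cnorm (repr (upi f) j))).
rewrite (le_lt_trans (ler_normD _ _))// ltrD//.
rewrite (le_lt_trans (cnorm_dist _ _))//.
by move: h2; rewrite ger0_norm ?cnorm_ge0.
Qed.

Lemma ucnormE (f : bfam) (l : R) : (fun j => cnorm (f j)) @ V --> l -> ucnorm (upi f) = l.
Proof.
move=> fl; have h := @ucnorm_cvg f.
by apply: (cvg_unique _ h fl); exact: norm_hausdorff.
Qed.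

Definition uadd (x y : ultraproduct) := upi (bfamD (repr x) (repr y)).
Definition uopp (x : ultraproduct) := upi (bfamN (repr x)).
Definition umul (x y : ultraproduct) := upi (bfamM (repr x) (repr y)).
Definition uscale (c : R[i]) (x : ultraproduct) := upi (bfamZ c (repr x)).
Definition ustar (x : ultraproduct) := upi (bfam_star (repr x)).

Lemma uaddE f g : uadd (upi f) (upi g) = upi (bfamD f g).
Proof.
apply/upiP; have h := cvg0D (repr_upi f) (repr_upi g).
apply: (bfam_eqv_le h) => j /=.
by rewrite opprD addrACA cnormD.
Qed.

Lemma uoppE f : uopp (upi f) = upi (bfamN f).
Proof.
apply/upiP; apply: (bfam_eqv_le (repr_upi f)) => j /=.
by rewrite -opprD cnormN.
Qed.

Lemma umulE f g : umul (upi f) (upi g) = upi (bfamM f g).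
Proof.
have [M _ fM] := bfam_bound (repr (upi f)); have [N _ gN] := bfam_bound g.
apply/upiP.
have h := cvg0D (cvg0Z M (repr_upi g)) (cvg0Z N (repr_upi f)).
apply: (bfam_eqv_le h) => j /=.
rewrite -(subrKA (repr (upi f) j * g j)) -mulrBr -mulrBl.
rewrite (le_trans (cnormD _ _))// lerD// (le_trans (cnormM _ _))//.
  by rewrite ler_wpM2r// cnorm_ge0.
by rewrite mulrC ler_wpM2r// cnorm_ge0.
Qed.

Lemma uscaleE c f : uscale c (upi f) = upi (bfamZ c f).
Proof.
apply/upiP; have h := cvg0Z (Normc.normc c) (repr_upi f).
apply: (bfam_eqv_le h) => j /=.
by rewrite -scalerBr cnormZ.
Qed.

Lemma ustarE f : ustar (upi f) = upi (bfam_star f).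
Proof.
apply/upiP; apply: (bfam_eqv_le (repr_upi f)) => j /=.
by rewrite -starN -starD cnorm_star.
Qed.

Let upi_ext (f g : bfam) : (forall j, f j = g j) -> upi f = upi g.
Proof. by move=> /bfam_eq ->. Qed.

Fact uaddA : associative uadd.
Proof.
move=> x y z; have [[[f ->] [g ->]] [h ->]] := (upi_surj x, upi_surj y, upi_surj z).
by rewrite !uaddE; apply: upi_ext => j /=; rewrite addrA.
Qed.

Fact uaddC : commutative uadd.
Proof.
move=> x y; have [[f ->] [g ->]] := (upi_surj x, upi_surj y).
by rewrite !uaddE; apply: upi_ext => j /=; rewrite addrC.
Qed.

Fact uadd0 : left_id (upi bfam0) uadd.
Proof.
move=> x; have [f ->] := upi_surj x.
by rewrite !uaddE; apply: upi_ext => j /=; rewrite add0r.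
Qed.

Fact uaddN : left_inverse (upi bfam0) uopp uadd.
Proof.
move=> x; have [f ->] := upi_surj x.
by rewrite uoppE uaddE; apply: upi_ext => j /=; rewrite addNr.
Qed.

HB.instance Definition _ :=
  GRing.isZmodule.Build ultraproduct uaddA uaddC uadd0 uaddN.

Fact umulA : associative umul.
Proof.
move=> x y z; have [[[f ->] [g ->]] [h ->]] := (upi_surj x, upi_surj y, upi_surj z).
by rewrite !umulE; apply: upi_ext => j /=; rewrite mulrA.
Qed.

Fact umul1l : left_id (upi bfam1) umul.
Proof.
move=> x; have [f ->] := upi_surj x.
by rewrite !umulE; apply: upi_ext => j /=; rewrite mul1r.
Qed.

Fact umul1r : right_id (upi bfam1) umul.
Proof.
move=> x; have [f ->] := upi_surj x.
by rewrite !umulE; apply: upi_ext => j /=; rewrite mulr1.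
Qed.

Fact umulDl : left_distributive umul uadd.
Proof.
move=> x y z; have [[[f ->] [g ->]] [h ->]] := (upi_surj x, upi_surj y, upi_surj z).
by rewrite !(uaddE, umulE); apply: upi_ext => j /=; rewrite mulrDl.
Qed.

Fact umulDr : right_distributive umul uadd.
Proof.
move=> x y z; have [[[f ->] [g ->]] [h ->]] := (upi_surj x, upi_surj y, upi_surj z).
by rewrite !(uaddE, umulE); apply: upi_ext => j /=; rewrite mulrDr.
Qed.

Fact uone_neq0 : upi bfam1 != upi bfam0.
Proof.
apply/eqP => /(congr1 ucnorm).
rewrite (@ucnormE _ 1); last by under eq_fun do rewrite cnorm1; exact: cvg_cst.
rewrite (@ucnormE _ 0); last by under eq_fun do rewrite cnorm0; exact: cvg_cst.
by apply/eqP; rewrite oner_eq0.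
Qed.

HB.instance Definition _ := GRing.Zmodule_isNzRing.Build ultraproduct
  umulA umul1l umul1r umulDl umulDr uone_neq0.

Fact uscaleA a b x : uscale a (uscale b x) = uscale (a * b) x.
Proof.
have [f ->] := upi_surj x.
by rewrite !uscaleE; apply: upi_ext => j /=; rewrite scalerA.
Qed.

Fact uscale1 : left_id 1 uscale.
Proof.
move=> x; have [f ->] := upi_surj x.
by rewrite uscaleE; apply: upi_ext => j /=; rewrite scale1r.
Qed.

Fact uscaleDr : right_distributive uscale +%R.
Proof.
move=> c x y; have [[f ->] [g ->]] := (upi_surj x, upi_surj y).
rewrite /GRing.add/= !(uaddE, uscaleE).
by apply: upi_ext => j /=; rewrite scalerDr.
Qed.

Fact uscaleDl x : {morph uscale^~ x : a b / a + b}.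
Proof.
move=> a b; have [f ->] := upi_surj x.
rewrite [RHS]/GRing.add/= !(uaddE, uscaleE).
by apply: upi_ext => j /=; rewrite scalerDl.
Qed.

HB.instance Definition _ := GRing.Zmodule_isLmodule.Build R[i] ultraproduct
  uscaleA uscale1 uscaleDr uscaleDl.

Fact uscaleAl (c : R[i]) (x y : ultraproduct) : c *: (x * y) = c *: x * y.
Proof.
have [[f ->] [g ->]] := (upi_surj x, upi_surj y).
rewrite /GRing.scale/= /GRing.mul/= !(umulE, uscaleE).
by apply: upi_ext => j /=; rewrite scalerAl.
Qed.

HB.instance Definition _ := GRing.Lmodule_isLalgebra.Build R[i] ultraproduct
  uscaleAl.

Fact uscaleAr (c : R[i]) (x y : ultraproduct) : c *: (x * y) = x * (c *: y).
Proof.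
have [[f ->] [g ->]] := (upi_surj x, upi_surj y).
rewrite /GRing.scale/= /GRing.mul/= !(umulE, uscaleE).
by apply: upi_ext => j /=; rewrite scalerAr.
Qed.

HB.instance Definition _ := GRing.Lalgebra_isAlgebra.Build R[i] ultraproduct
  uscaleAr.

Lemma upiD f g : upi f + upi g = upi (bfamD f g). Proof. exact: uaddE. Qed.
Lemma upiN f : - upi f = upi (bfamN f). Proof. exact: uoppE. Qed.
Lemma upiM f g : upi f * upi g = upi (bfamM f g). Proof. exact: umulE. Qed.
Lemma upiZ c f : c *: upi f = upi (bfamZ c f). Proof. exact: uscaleE. Qed.

Lemma upiB f g : upi f - upi g = upi (bfamD f (bfamN g)).
Proof. by rewrite upiN upiD. Qed.

Let V_le (a b : J -> R) (x y : R) : a @ V --> x -> b @ V --> y ->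
  (forall j, a j <= b j) -> x <= y.
Proof.
move=> ax yb ab.
rewrite -subr_ge0; apply: (@cvgr_to_ge _ V _ _ (fun j => b j - a j)).
  exact: cvgB.
by apply: filterE => j; rewrite subr_ge0.
Qed.

Lemma ucnorm_le (f : bfam) (r : R) : (forall j, cnorm (f j) <= r) -> ucnorm (upi f) <= r.
Proof. by move=> fr; apply: (V_le (@ucnorm_cvg f) (cvg_cst r : (fun=> r) @ V --> r)). Qed.

Fact ustarD (x y : ultraproduct) : ustar (x + y) = ustar x + ustar y.
Proof.
have [[f ->] [g ->]] := (upi_surj x, upi_surj y).
by rewrite upiD !ustarE upiD; apply: upi_ext => j /=; rewrite starD.
Qed.

Fact ustarZ (c : R[i]) (x : ultraproduct) : ustar (c *: x) = c^* *: ustar x.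
Proof.
have [f ->] := upi_surj x.
by rewrite upiZ !ustarE upiZ; apply: upi_ext => j /=; rewrite starZ.
Qed.

Fact ustarM (x y : ultraproduct) : ustar (x * y) = ustar y * ustar x.
Proof.
have [[f ->] [g ->]] := (upi_surj x, upi_surj y).
by rewrite upiM !ustarE upiM; apply: upi_ext => j /=; rewrite starM.
Qed.

Fact ustarK (x : ultraproduct) : ustar (ustar x) = x.
Proof.
have [f ->] := upi_surj x.
by rewrite !ustarE; apply: upi_ext => j /=; rewrite starK.
Qed.

Fact ucnormD (x y : ultraproduct) : ucnorm (x + y) <= ucnorm x + ucnorm y.
Proof.
have [[f ->] [g ->]] := (upi_surj x, upi_surj y).
rewrite upiD; apply: (V_le (@ucnorm_cvg _) (cvgD (@ucnorm_cvg f) (@ucnorm_cvg g))).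
by move=> j /=; exact: cnormD.
Qed.

Fact ucnormZ (c : R[i]) (x : ultraproduct) :
  ucnorm (c *: x) = Normc.normc c * ucnorm x.
Proof.
have [f ->] := upi_surj x; rewrite upiZ; apply: ucnormE => /=.
under eq_fun do rewrite cnormZ.
by apply: cvgMr; exact: ucnorm_cvg.
Qed.

Fact ucnorm0_eq0 (x : ultraproduct) : ucnorm x = 0 -> x = 0.
Proof.
have [f ->] := upi_surj x => f0; apply/upiP.
have := @ucnorm_cvg f; rewrite f0 => h.
by apply: (bfam_eqv_le h) => j /=; rewrite subr0.
Qed.

Fact ucnormM (x y : ultraproduct) : ucnorm (x * y) <= ucnorm x * ucnorm y.
Proof.
have [[f ->] [g ->]] := (upi_surj x, upi_surj y).
rewrite upiM; apply: (V_le (@ucnorm_cvg _) (cvgM (@ucnorm_cvg f) (@ucnorm_cvg g))).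
by move=> j /=; exact: cnormM.
Qed.

Fact ucnorm_star_mul (x : ultraproduct) : ucnorm (ustar x * x) = ucnorm x ^+ 2.
Proof.
have [f ->] := upi_surj x; rewrite ustarE upiM; apply: ucnormE => /=.
under eq_fun do rewrite cnorm_star_mul expr2.
by rewrite expr2; apply: cvgM; exact: ucnorm_cvg.
Qed.

Lemma ultraproduct_lift (x : ultraproduct) (r : R) : ucnorm x < r ->
  exists2 f : bfam, x = upi f & forall j, cnorm (f j) <= r.
Proof.
have [f ->] := upi_surj x => fr.
have r0 : 0 <= r.
  rewrite ltW// (le_lt_trans _ fr)//.
  by apply: (V_le (cvg_cst 0 : (fun=> 0) @ V --> (0 : R)) (@ucnorm_cvg f)) => j; exact: cnorm_ge0.
pose g j : F j := if cnorm (f j) <= r then f j else 0.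
have gr j : cnorm (g j) <= r by rewrite /g; case: ifPn; rewrite ?cnorm0.
exists (BFam (ex_intro _ r gr)) => //; apply/upiP/bfam_eqvP => e e0.
have : \forall j \near V, cnorm (f j) < r.
  have h := @ucnorm_cvg f.
  by apply: (cvgr_lt (ucnorm (upi f))).
by apply: filterS => j /ltW h; rewrite /= /g h subrr cnorm0.
Qed.

Let half_lt (c e : R) : 0 < c -> 0 < e -> exists k, c * 2^-1 ^+ k < e.
Proof.
move=> c0 e0.
have h : (fun k => (2^-1 : R) ^+ k) @ \oo --> 0.
  by apply: cvg_expr; rewrite ger0_norm ?invr_ge0// invf_lt1// ltr1n.
have /cvgr0Pnorm_lt/(_ (e / c)) := h.
rewrite divr_gt0// => /(_ isT)[k _ /(_ k)]/= /(_ (leqnn k)).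
rewrite ger0_norm ?exprn_ge0 ?invr_ge0// ltr_pdivlMr// mulrC => ?.
by exists k.
Qed.

Fact ucnorm_complete : norm_complete ucnorm.
Proof.
move=> u u_cauchy; pose p k : R := 2^-1 ^+ k.
have p0 k : 0 < p k by rewrite exprn_gt0// invr_gt0.
have pS k : p k = p k.+1 + p k.+1 by rewrite /p exprS; lra.
have [N NP] := choice (fun k => u_cauchy _ (p0 k)).
pose M k := (\sum_(i < k.+1) N i)%N.
have NM k : (N k <= M k)%N by rewrite /M big_ord_recr leq_addl.
have MS k : (M k <= M k.+1)%N by rewrite /M [leqRHS]big_ord_recr leq_addr.
pose v k := u (M k).
have vP k : ucnorm (v k.+1 - v k) < p k.
  by apply: NP; [exact: leq_trans (MS k)|].
have dS k : exists f : bfam,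
    v k.+1 - v k = upi f /\ forall j, cnorm (f j) <= p k.
  by have [f fE fP] := ultraproduct_lift (vP k); exists f.
have [d dP] := choice dS.
have [f0 f0P] := upi_surj (v 0).
pose s := fix s k := if k is k'.+1 then bfamD (s k') (d k') else f0.
have sv k : upi (s k) = v k.
  elim: k => [//|k IH]; rewrite /= -upiD IH -(dP k).1.
  by rewrite addrC subrK.
have s_dist0 k i j : cnorm (s (k + i)%N j - s k j) <= 2 * p k - 2 * p (k + i)%N.
  elim: i => [|i IH]; first by rewrite addn0 !subrr cnorm0.
  rewrite addnS /= addrAC (le_trans (cnormD _ _))//.
  rewrite (le_trans (lerD IH (proj2 (dP _) j)))// [p (k + i)%N]pS.
  by rewrite !mulr_natl !mulr2n !opprD; lra.
have s_dist k n j : (k <= n)%N -> cnorm (s n j - s k j) <= 2 * p k.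
  move=> /subnKC <-; rewrite (le_trans (s_dist0 _ _ _))// gerBl.
  by rewrite mulr_ge0// ltW.
have s_cvg j : exists l, forall e, 0 < e -> exists n0 : nat,
    forall n, (n0 <= n)%N -> cnorm (s n j - l) < e.
  apply: cnorm_complete => e e0; have [k ke] := @half_lt 4 _ (ltr0n _ _) e0.
  exists k => m n km kn; apply: le_lt_trans ke.
  have := lerD (s_dist _ _ j km) (s_dist _ _ j kn).
  rewrite [X in _ + X]cnormB => h; rewrite -(subrKA (s k j)).
  rewrite (le_trans (cnormD _ _))// (le_trans h)// -/(p k); lra.
pose l j := projT1 (cid (s_cvg j)).
have lP j : forall e, 0 < e -> exists n0 : nat,
    forall n, (n0 <= n)%N -> cnorm (s n j - l j) < e := projT2 (cid (s_cvg j)).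
have l_dist k j : cnorm (l j - s k j) <= 2 * p k.
  apply/ler_addgt0Pr => e e0; have [n0 hn] := lP j _ e0.
  have := hn (maxn k n0); rewrite leq_maxr => /(_ isT) h.
  rewrite -(subrKA (s (maxn k n0) j)) (le_trans (cnormD _ _))// addrC lerD//.
    by apply: s_dist; rewrite leq_maxl.
  by rewrite cnormB ltW.
have [B _ f0B] := bfam_bound f0.
have lB j : cnorm (l j) <= 2 * p 0 + B.
  rewrite -(subrK (s 0 j) (l j)) (le_trans (cnormD _ _))//.
  exact: lerD (l_dist 0%N j) (f0B j).
pose L := BFam (ex_intro _ _ lB).
exists (upi L) => e e0; have [k ke] := @half_lt 3 _ (ltr0n _ _) e0.
exists (M k) => n Mn; apply: le_lt_trans ke.
rewrite -(subrKA (v k)) (le_trans (ucnormD _ _))//.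
have -> : 3 * 2^-1 ^+ k = p k + 2 * p k :> R by rewrite /p; lra.
rewrite lerD//; first by rewrite ltW// NP// (leq_trans (NM k)).
by rewrite -sv upiB; apply: ucnorm_le => j /=; rewrite cnormB; exact: l_dist.
Qed.

HB.instance Definition _ := isCStarAlgebra.Build R ultraproduct
  ustarD ustarZ ustarM ustarK ucnormD ucnormZ ucnorm0_eq0 ucnormM
  ucnorm_star_mul ucnorm_complete.

End UltraproductDef.

(* ultraproduct F UV : cstarType R is the quotient of the bounded families of
   elements of the F j by bfam_eqv; upi UV is the quotient map. *)
Arguments ultraproduct {R J V} F UV.

(* *-polynomials and formulas over a type V of free variables.  A quantifier
   binds the variable None of option V. *)
Inductive starpoly (R : realType) (V : Type) : Type :=
| PVar of V
| POne
| PScale of R[i] & starpoly R V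
| PAdd of starpoly R V & starpoly R V
| PMul of starpoly R V & starpoly R V
| PStar of starpoly R V.

Inductive formula (R : realType) (V : Type) : Type :=
| FNorm of starpoly R V
| FConn (k : nat) (c : 'rV[R]_k -> R) of continuous c & ('I_k -> formula R V)
| FSup of formula R (option V)
| FInf of formula R (option V).

Definition sentence (R : realType) : Type := formula R Empty_set.

Section Interpretation.
Context {R : realType} (A : cstarType R).

Fixpoint peval (V : Type) (rho : V -> A) (p : starpoly R V) : A :=
  match p with
  | PVar v => rho v
  | POne => 1
  | PScale c p => c *: peval rho p
  | PAdd p q => peval rho p + peval rho q
  | PMul p q => peval rho p * peval rho q
  | PStar p => star (peval rho p)
  end.

Definition assign (V : Type) (rho : V -> A) (x : A) : option V -> A :=
  fun v => if v is Some w then rho w else x.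

Definition unit_ball : set A := [set x | cnorm x <= 1].

(* sup and inf are those of R, which are junk on unbounded sets; here the sets
   are nonempty and bounded, since by induction a formula takes bounded values
   when its free variables range over bounded sets. *)
Fixpoint feval (V : Type) (rho : V -> A) (phi : formula R V) {struct phi} : R :=
  match phi with
  | FNorm p => cnorm (peval rho p)
  | FConn k c _ phis => c (\row_i feval rho (phis i))
  | FSup phi => sup [set feval (assign rho x) phi | x in unit_ball]
  | FInf phi => inf [set feval (assign rho x) phi | x in unit_ball]
  end.

Definition sentence_value (phi : sentence R) : R :=
  feval (fun v : Empty_set => match v with end) phi.

Definition finite_dimensional : Prop :=
  exists (n : nat) (f : {linear 'rV[R[i]]_n -> A}), bijective f.

Definition unitaries : set A := [set u | star u * u = 1 /\ u * star u = 1].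

Definition center : set A := [set z | forall x, z * x = x * z].

Definition convex_hull (S : set A) : set A :=
  [set x | exists (n : nat) (t : 'I_n -> R) (s : 'I_n -> A),
     [/\ forall i, 0 <= t i, \sum_i t i = 1, forall i, S (s i) &
         x = \sum_i (t i)%:C *: s i]].

Definition norm_closure (S : set A) : set A :=
  [set x | forall e, 0 < e -> exists2 y, S y & cnorm (x - y) < e].

Definition dixmier_property : Prop := forall a : A,
  norm_closure (convex_hull [set u * a * star u | u in unitaries]) `&` center
    !=set0.

End Interpretation.

Definition elementarily_equivalent (R : realType) (A B : cstarType R) : Prop :=
  forall phi : sentence R, sentence_value A phi = sentence_value B phi.

Definition pseudocompact (R : realType) (A : cstarType R) : Prop :=
  exists (J : Type) (V : set_system J) (UV : UltraFilter V)
         (F : J -> cstarType R),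
    (forall j, finite_dimensional (F j)) /\
    elementarily_equivalent A (ultraproduct F UV).

(* Main.v *)
Require Import Defs.
From mathcomp Require Import all_boot all_order all_algebra.
From mathcomp Require Import all_classical all_reals all_analysis.
From mathcomp Require Import complex ring lra.

(** The idea is to express the Dixmier property, up to any precision, by a
    sentence that holds in all finite-dimensional C*-algebras with a number of
    unitaries independent of the dimension.

    In a finite-dimensional algebra a self-adjoint element is a real combination
    of orthogonal minimal projections e_i ([diagonalization]).  Call i and j
    linked if a partial isometry carries e_j to e_i; otherwise e_i A e_j = 0
    ([unlinked_eq0]).  A permutation that preserves the classes of linked indices
    is implemented by a unitary u.  Choosing the one that reverses the order of
    the eigenvalues in each class, the mean of a and u a u* is again diagonal, and
    its eigenvalues oscillate half as much on each class ([avg_halves_osc]).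
    After n such means the element is within a constant times 2 ^ (- n) of one
    whose eigenvalues are constant on each class, that is, of a central element.
    Treating the self-adjoint and skew-adjoint parts in turn gives
    [fd_averaging]: 2 n means make all commutators with the unit ball small, with
    constants that do not depend on the algebra.

    The statement that m means suffice is a sentence ([feval_defect]): quantify
    over m elements u of the unit ball, penalizing the failure of u to be unitary,
    and measure the norms of commutators rather than the distance to the center.
    It passes to ultraproducts ([defect_upi_le]), hence to every pseudocompact A.
    There, approximate unitaries are replaced by unitaries by means of Newton's
    iteration ([unitary_near]), and every element has unitary averages with
    arbitrarily small commutators ([averaging]).

    Finally, averaging an element whose commutators are at most d moves it by d at
    most ([cnorm_avgs_sub]).  Successive averages of a with commutator bounds
    2 ^ (- n) thus form a Cauchy sequence, whose limit is central and lies in the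
    closed convex hull of the unitary conjugates of a. *)

Set Implicit Arguments.
Unset Strict Implicit.
Unset Printing Implicit Defensive.

Import Order.TTheory GRing.Theory Num.Theory.
Import numFieldNormedType.Exports.
Import ComplexField.

Local Open Scope classical_set_scope.
Local Open Scope ring_scope.
Local Open Scope complex_scope.

(** * Estimates on real numbers, and a permutation *)

Section Reals.
Context {R : realType}.
Implicit Types (r e : R).

Lemma geom_small r e : 0 < e -> exists n, r * 2^-1 ^+ n < e.
Proof.
move=> e0; exists (Num.bound (`|r| / e)); set n := Num.bound _.
have h : `|r| / e < n%:R := archi_boundP (divr_ge0 (normr_ge0 _) (ltW e0)).
have h2 : n%:R <= 2 ^+ n :> R by rewrite -natrX ler_nat ltnW// ltn_expl.
rewrite exprVn ltr_pdivrMr ?exprn_gt0//.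
rewrite (le_lt_trans (ler_norm _))// mulrC -ltr_pdivrMr//.
exact: lt_le_trans h2.
Qed.

Lemma le0_geom (x : R) r : (forall n, x <= r * 2^-1 ^+ n) -> x <= 0.
Proof.
move=> h; apply/ler_addgt0Pl => e e0; rewrite addr0.
by have [n hn] := geom_small r e0; exact: le_trans (h n) (ltW hn).
Qed.

(** Bernoulli's inequality makes (r / d) ^ (2 ^ n) outgrow m as soon as
    r > d.  Exponents 2 ^ n are those that the C*-identity gives for the norm of
    a self-adjoint element. *)
Lemma le_pow2 (m r d : R) : 0 <= d ->
  (forall n, r ^+ (2 ^ n) <= m * d ^+ (2 ^ n)) -> r <= d.
Proof.
move=> d0 h; rewrite leNgt; apply/negP => dr.
move: d0; rewrite le_eqVlt => /predU1P[d0|d0].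
  by have := h 0%N; rewrite expr1 -d0 mulr0 leNgt d0 dr.
pose t := r / d - 1.
have t0 : 0 < t by rewrite subr_gt0 ltr_pdivlMr// mul1r.
have bern n : 1 + 2 ^+ n * t <= (1 + t) ^+ (2 ^ n).
  elim: n => [|n IH]; first by rewrite mul1r expr1.
  rewrite expnSr exprM expr2 exprS.
  have p0 : 0 < 2 ^+ n * t by rewrite mulr_gt0// exprn_gt0.
  have : (1 + 2 ^+ n * t) * (1 + 2 ^+ n * t) <=
     (1 + t) ^+ (2 ^ n) * (1 + t) ^+ (2 ^ n) by rewrite ler_pM//; lra.
  by apply: le_trans; nra.
have [n hn] := geom_small m t0.
have : m < 2 ^+ n * t by move: hn; rewrite exprVn ltr_pdivrMr ?exprn_gt0// mulrC.
have := h n; rewrite -ler_pdivrMr ?exprn_gt0// -expr_div_n.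
have t1 : 1 + t = r / d by rewrite /t addrC subrK.
by have := bern n; rewrite t1; lra.
Qed.

(** In each class, exchange the k-th smallest value of x with the k-th largest.
    Along such an s the differences x i - x j and x (s i) - x (s j) have opposite
    signs, so their mean is at most half of the larger one in absolute value:
    this is where the factor 1/2 of [avg_halves_osc] comes from. *)
Lemma order_reversing_perm (I : finType) (rl : rel I) (x : I -> R) :
  equivalence_rel rl -> exists s : I -> I,
  [/\ injective s, forall i, rl i (s i) &
    forall i j, rl i j -> (x i <= x j /\ x (s j) <= x (s i)) \/
                          (x j <= x i /\ x (s i) <= x (s j))].
Proof.
move=> rlE; have rr i : rl i i by case: (rlE i i i).
have rsub i j : rl i j -> rl i =1 rl j by move=> h z; case: (rlE i j z) => _ ->.
pose leT i j := x i <= x j.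
have leT_total : total leT by move=> i j; exact: le_total.
have leT_trans : transitive leT by move=> j i k; exact: le_trans.
have leT_refl : reflexive leT by move=> j; exact: lexx.
(* the class of i, by increasing x; it depends on i only through its class *)
pose S i := sort leT (enum (rl i)).
have memS i j : (j \in S i) = rl i j by rewrite mem_sort mem_enum.
have uS i : uniq (S i) by rewrite sort_uniq enum_uniq.
have sS i : sorted leT (S i) by apply: sort_sorted.
have SE i j : rl i j -> S i = S j by move=> /rsub h; rewrite /S (eq_enum h).
have iS i : (index i (S i) < size (S i))%N by rewrite index_mem memS.
have rS i : (size (S i) - (index i (S i)).+1 < size (S i))%N.
  by rewrite ltn_subrL /= (leq_ltn_trans _ (iS i)).
pose s i := nth i (S i) (size (S i) - (index i (S i)).+1).
have rs i : rl i (s i) by rewrite -memS mem_nth.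
(* ties in x are broken by the position in the sorted class *)
have mono i j : rl i j -> (index i (S i) <= index j (S j))%N ->
    x i <= x j /\ x (s j) <= x (s i).
  move=> /SE Sij; have := iS j; have := rS j; have := rS i; have := iS i.
  rewrite /s Sij => h1 h2 h3 h4 h5; split.
    have := sorted_leq_nth leT_trans leT_refl i (sS j) _ _ h1 h4 h5.
    by rewrite /leT !nth_index ?memS// -memS -Sij memS.
  rewrite (set_nth_default i)//.
  by apply: (sorted_leq_nth leT_trans leT_refl i (sS j)); rewrite ?inE// leq_sub2l.
exists s; split=> // [i j sij|i j rij]; last first.
  have [h|/ltnW h] := leqP (index i (S i)) (index j (S j)).
    by left; apply: mono.
  by right; apply: mono => //; case: (rlE i j i) => _ <-.
have Sij : S i = S j by rewrite (SE _ _ (rs i)) sij -(SE _ _ (rs j)).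
have iSj : i \in S j by rewrite -Sij memS.
move: sij; rewrite /s (set_nth_default j)//; move: (rS i) (rS j) (iS i) (iS j).
rewrite Sij => h1 h2 h3 h4 /eqP; rewrite nth_uniq// => /eqP h.
rewrite -(nth_index j iSj) -[RHS](nth_index j (_ : j \in S j)) ?memS//.
by move/eqP: h; rewrite eqn_sub2lE// => /eqP[->].
Qed.

End Reals.

(** * Unitary averages and commutator bounds *)

Section Basics.
Context {R : realType} {A : cstarType R}.
Implicit Types (a b c e f h u v w x y z : A) (r s t d : R).

Lemma normc_real r : Normc.normc r%:C = `|r|.
Proof. by rewrite /Normc.normc /= expr0n addr0 sqrtr_sqr. Qed.

Lemma conj_real r : Num.conj (r%:C : R[i]) = r%:C.
Proof. by apply/eqP; rewrite eq_complex /= oppr0 !eqxx. Qed.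

Lemma cnormZr r x : cnorm (r%:C *: x) = `|r| * cnorm x.
Proof. by rewrite cnormZ normc_real. Qed.

Lemma starZr r x : star (r%:C *: x) = r%:C *: star x.
Proof. by rewrite starZ conj_real. Qed.

Lemma starB x y : star (x - y) = star x - star y.
Proof. by rewrite starD starN. Qed.

Lemma star_sum (I : Type) (s : seq I) (P : pred I) (F : I -> A) :
  star (\sum_(i <- s | P i) F i) = \sum_(i <- s | P i) star (F i).
Proof. by apply: (big_morph star) => [x y|]; rewrite ?starD ?star0. Qed.

Lemma cnorm_sum (I : Type) (s : seq I) (P : pred I) (F : I -> A) :
  cnorm (\sum_(i <- s | P i) F i) <= \sum_(i <- s | P i) cnorm (F i).
Proof.
elim/big_ind2: _ => [|x1 x2 y1 y2 h1 h2|//]; first by rewrite cnorm0.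
by rewrite (le_trans (cnormD _ _))// lerD.
Qed.

Lemma star_mul_eq0 x : star x * x = 0 -> x = 0.
Proof.
move=> h; apply: cnorm0_eq0; apply/eqP; rewrite -sqrf_eq0.
by rewrite -cnorm_star_mul h cnorm0.
Qed.

Lemma cnorm_triangle z x y : cnorm (x - y) <= cnorm (x - z) + cnorm (z - y).
Proof. by rewrite -(subrKA z) cnormD. Qed.

Lemma cnorm_mul_le x y r s : cnorm x <= r -> cnorm y <= s ->
  cnorm (x * y) <= r * s.
Proof.
by move=> hx hy; rewrite (le_trans (cnormM _ _))// ler_pM// cnorm_ge0.
Qed.

Lemma unitary1 : unitaries (1 : A).
Proof. by split; rewrite star1 mulr1. Qed.

Lemma unitaryM u v : unitaries u -> unitaries v -> unitaries (u * v).
Proof.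
move=> [u1 u2] [v1 v2]; split; rewrite starM mulrA.
  by rewrite -(mulrA (star v)) u1 mulr1.
by rewrite -(mulrA u) v2 mulr1.
Qed.

Lemma cnorm_unitary u : unitaries u -> cnorm u = 1.
Proof.
move=> [u1 _]; apply/eqP; rewrite -sqrp_eq1 ?cnorm_ge0//.
by rewrite -cnorm_star_mul u1 cnorm1.
Qed.

(** A quantitative form of centrality.  It is stated without a distance to the
    center, which is what allows it to be written as a formula. *)
Definition comm_le c d := forall x, cnorm (c * x - x * c) <= d * cnorm x.

Lemma comm_le_cnorm c : comm_le c (2 * cnorm c).
Proof.
move=> x; rewrite (le_trans (cnormD _ _))// cnormN.
have := cnormM c x; have := cnormM x c; rewrite (mulrC (cnorm x)) => h1 h2.
by rewrite -mulrA mulr_natl mulr2n lerD.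
Qed.

Lemma comm_le_center c d z : Defs.center z -> cnorm (c - z) <= d -> comm_le c (2 * d).
Proof.
move=> cz h x.
have -> : c * x - x * c = (c - z) * x - x * (c - z).
  by rewrite mulrBl mulrBr cz opprB addrA subrK.
by rewrite (le_trans (comm_le_cnorm _ x))// ler_wpM2r ?cnorm_ge0// ler_pM2l.
Qed.

Lemma comm_leW c d d' : d <= d' -> comm_le c d -> comm_le c d'.
Proof.
by move=> dd h x; rewrite (le_trans (h x))// ler_wpM2r// cnorm_ge0.
Qed.

Lemma comm_leD b c d d' : comm_le b d -> comm_le c d' -> comm_le (b + c) (d + d').
Proof.
move=> hb hc x; rewrite mulrDl mulrDr opprD addrACA.
by rewrite (le_trans (cnormD _ _))// mulrDl lerD.
Qed.

Lemma comm_leZ (k : R[i]) c d : comm_le c d -> comm_le (k *: c) (Normc.normc k * d).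
Proof.
move=> h x; rewrite -scalerAl -scalerAr -scalerBr cnormZ -mulrA ler_wpM2l//.
by case: k => p q; exact: sqrtr_ge0.
Qed.

(** The commutator of [u c u*] with x is the conjugate by u of that of c
    with [u* x u]. *)
Lemma comm_le_conj u c d : unitaries u -> comm_le c d -> comm_le (u * c * star u) d.
Proof.
move=> Uu h x; have [u1 u2] := Uu.
have -> : u * c * star u * x - x * (u * c * star u) =
    u * (c * (star u * x * u) - star u * x * u * c) * star u.
  rewrite mulrBr mulrBl; congr (_ - _); rewrite !mulrA.
    by rewrite -[RHS]mulrA u2 mulr1.
  by rewrite u2 mul1r.
rewrite (le_trans (cnormM _ _))// cnorm_star (cnorm_unitary Uu) mulr1.
rewrite (le_trans (cnormM _ _))// (cnorm_unitary Uu) mul1r.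
have d0 : 0 <= d by have := h 1; rewrite mulr1 mul1r subrr cnorm0 cnorm1 mulr1.
rewrite (le_trans (h _))// ler_wpM2l//.
rewrite (le_trans (cnormM _ _))// (cnorm_unitary Uu) mulr1.
by rewrite (le_trans (cnormM _ _))// cnorm_star (cnorm_unitary Uu) mul1r.
Qed.

(** [u c u* - c] is, up to a unitary factor, the commutator of c and u. *)
Lemma cnorm_conj_sub u c d : unitaries u -> comm_le c d ->
  cnorm (u * c * star u - c) <= d.
Proof.
move=> Uu h; have [u1 u2] := Uu.
have -> : u * c * star u - c = - ((c * u - u * c) * star u).
  by rewrite mulrBl opprB -[c * u * _]mulrA u2 mulr1.
rewrite cnormN (le_trans (cnormM _ _))// cnorm_star.
have := h u; rewrite (cnorm_unitary Uu) !mulr1.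
exact.
Qed.

(** The only averages used are iterated means of an element and one of its
    unitary conjugates: one quantifier of a formula handles each of them. *)
Definition avg u b : A := (2^-1)%:C *: (b + u * b * star u).

Lemma half_double x : (2^-1)%:C *: (x + x) = x.
Proof.
rewrite -[x in LHS]scale1r -scalerDl scalerA -(rmorph1 (real_complex R)).
rewrite -rmorphD -rmorphM/=.
have -> : 2^-1 * (1 + 1) = 1 :> R by field.
by rewrite scale1r.
Qed.

Lemma cnorm_half x y d : cnorm x <= d -> cnorm y <= d ->
  cnorm ((2^-1)%:C *: (x + y)) <= d.
Proof.
move=> hx hy; rewrite cnormZr ger0_norm ?invr_ge0//.
have := cnormD x y; lra.
Qed.

Lemma halfB x y z : (2^-1)%:C *: (x + y) - z = (2^-1)%:C *: ((x - z) + (y - z)).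
Proof. by rewrite addrACA -opprD [RHS]scalerBr half_double. Qed.

Lemma avg1 b : avg 1 b = b.
Proof. by rewrite /avg mul1r star1 mulr1 half_double. Qed.

Lemma avgD u b c : avg u (b + c) = avg u b + avg u c.
Proof. by rewrite /avg mulrDr mulrDl addrACA scalerDr. Qed.

Lemma avgZ u (k : R[i]) b : avg u (k *: b) = k *: avg u b.
Proof. by rewrite /avg -scalerAr -scalerAl -scalerDr !scalerA mulrC. Qed.

Lemma avgN u b : avg u (- b) = - avg u b.
Proof. by rewrite -scaleN1r avgZ scaleN1r. Qed.

Lemma avgB u b c : avg u (b - c) = avg u b - avg u c.
Proof. by rewrite avgD avgN. Qed.

Lemma star_avg u b : star (avg u b) = avg u (star b).
Proof. by rewrite /avg starZr starD !starM starK mulrA. Qed.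

Lemma cnorm_conj u b : cnorm u <= 1 -> cnorm (u * b * star u) <= cnorm b.
Proof.
move=> u1; rewrite -[leRHS]mulr1 cnorm_mul_le ?cnorm_star//.
by rewrite -[leRHS]mul1r cnorm_mul_le.
Qed.

Lemma cnorm_avg u b : cnorm u <= 1 -> cnorm (avg u b) <= cnorm b.
Proof. by move=> u1; apply: cnorm_half => //; exact: cnorm_conj. Qed.

Lemma comm_le_avg u b d : unitaries u -> comm_le b d -> comm_le (avg u b) d.
Proof.
move=> Uu h; have := comm_leZ (2^-1)%:C (comm_leD h (comm_le_conj Uu h)).
by rewrite normc_real ger0_norm ?invr_ge0// => /comm_leW; apply; lra.
Qed.

Lemma cnorm_avgB_unitary u v b : cnorm u <= 1 -> cnorm v <= 1 ->
  cnorm (avg u b - avg v b) <= cnorm (u - v) * cnorm b.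
Proof.
move=> u1 v1; rewrite /avg -scalerBr.
rewrite opprD addrACA subrr add0r.
have -> : u * b * star u - v * b * star v =
   (u - v) * b * star u + v * b * star (u - v).
  by rewrite starB mulrBr !mulrBl addrA subrK.
apply: cnorm_half.
  rewrite -[leRHS]mulr1 cnorm_mul_le ?cnorm_star//; exact: cnormM.
rewrite mulrC -[cnorm b]mul1r !cnorm_mul_le ?cnorm_star//.
Qed.

Definition avgs (us : seq A) b := foldl (fun c u => avg u c) b us.

Lemma avgsD us b c : avgs us (b + c) = avgs us b + avgs us c.
Proof. by elim: us b c => //= u us IH b c; rewrite avgD IH. Qed.

Lemma avgsZ us (k : R[i]) b : avgs us (k *: b) = k *: avgs us b.
Proof. by elim: us b => //= u us IH b; rewrite avgZ IH. Qed.

Lemma star_avgs us b : star (avgs us b) = avgs us (star b).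
Proof. by elim: us b => //= u us IH b; rewrite IH star_avg. Qed.

Lemma avgs_cat us vs b : avgs (us ++ vs) b = avgs vs (avgs us b).
Proof. exact: foldl_cat. Qed.

Definition all_unitary (us : seq A) := forall u, u \in us -> unitaries u.

Lemma all_unitary_cons u us :
  all_unitary (u :: us) <-> unitaries u /\ all_unitary us.
Proof.
split=> [h|[hu h] v]; last by rewrite inE => /orP[/eqP->|/h].
by split=> [|v vus]; apply: h; rewrite inE ?eqxx ?vus ?orbT.
Qed.

Lemma all_unitary_cat us vs :
  all_unitary us -> all_unitary vs -> all_unitary (us ++ vs).
Proof. by move=> hu hv w; rewrite mem_cat => /orP[/hu|/hv]. Qed.

Lemma cnorm_avgs us b : all_unitary us -> cnorm (avgs us b) <= cnorm b.
Proof.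
elim: us b => //= u us IH b /all_unitary_cons[hu /IH h].
by rewrite (le_trans (h _))// cnorm_avg// cnorm_unitary.
Qed.

Lemma comm_le_avgs us b d : all_unitary us -> comm_le b d -> comm_le (avgs us b) d.
Proof.
elim: us b => //= u us IH b /all_unitary_cons[hu /IH h] /(comm_le_avg hu).
exact: h.
Qed.

(** [avgs us b] is a convex combination of unitary conjugates of b, each within
    d of b.  The induction carries the bound for all conjugates of the current
    average, a property which is stable under a further average. *)
Lemma cnorm_avgs_sub us b d : all_unitary us -> comm_le b d ->
  cnorm (avgs us b - b) <= d.
Proof.
move=> hus hb.
have {hb} : forall w, unitaries w -> cnorm (w * b * star w - b) <= d.
  by move=> w /cnorm_conj_sub; exact.
suff : forall c, (forall w, unitaries w -> cnorm (w * c * star w - b) <= d) ->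
    forall w, unitaries w -> cnorm (w * avgs us c * star w - b) <= d.
  by move=> h /h /(_ 1 unitary1); rewrite star1 mulr1 mul1r.
elim: us hus => //= u us IH /all_unitary_cons[hu /IH{}IH] c hc.
apply: IH => w hw.
rewrite /avg -scalerAr -scalerAl mulrDr mulrDl halfB.
apply: cnorm_half; first exact: hc.
have -> : w * (u * c * star u) * star w = w * u * c * star (w * u).
  by rewrite starM !mulrA.
by apply: hc; apply: unitaryM.
Qed.

Lemma convex_hull_half (S : set A) x y : convex_hull S x -> convex_hull S y ->
  convex_hull S ((2^-1)%:C *: (x + y)).
Proof.
move=> [m [t [p [t0 t1 tS ->]]]] [n [s [q [s0 s1 sS ->]]]].
exists (m + n)%N,
  (fun i => match fintype.split i with inl j => 2^-1 * t j | inr j => 2^-1 * s j end),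
  (fun i => match fintype.split i with inl j => p j | inr j => q j end).
split.
- by move=> i; case: (fintype.split i) => j; rewrite mulr_ge0 ?invr_ge0.
- rewrite big_split_ord/=.
  under eq_bigr do rewrite (unsplitK (inl _)).
  under [X in _ + X]eq_bigr do rewrite (unsplitK (inr _)).
  by rewrite -!mulr_sumr t1 s1; lra.
- by move=> i; case: (fintype.split i) => j.
rewrite big_split_ord/=.
under [X in _ = X + _]eq_bigr do rewrite (unsplitK (inl _)) rmorphM/= -scalerA.
under [X in _ = _ + X]eq_bigr do rewrite (unsplitK (inr _)) rmorphM/= -scalerA.
by rewrite -!scaler_sumr -scalerDr.
Qed.

Lemma convex_hull_orbit_conj v a c : unitaries v ->
  convex_hull [set u * a * star u | u in @unitaries R A] c ->
  convex_hull [set u * a * star u | u in @unitaries R A] (v * c * star v).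
Proof.
move=> hv [n [t [s [t0 t1 tS ->]]]].
exists n, t, (fun i => v * s i * star v); split => //.
  move=> i; have [u hu <-] := tS i; exists (v * u); first exact: unitaryM.
  by rewrite starM !mulrA.
rewrite mulr_sumr mulr_suml; apply: eq_bigr => i _.
by rewrite -scalerAr -scalerAl.
Qed.

Lemma convex_hull_avgs us a : all_unitary us ->
  convex_hull [set u * a * star u | u in @unitaries R A] (avgs us a).
Proof.
move=> hus; set S := (X in convex_hull X).
suff : forall c, convex_hull S c -> convex_hull S (avgs us c).
  apply; exists 1%N, (fun=> 1), (fun=> a); split => //.
  - by rewrite big_ord1.
  - by move=> _; exists 1; [exact: unitary1|rewrite star1 mulr1 mul1r].
  - by rewrite big_ord1 scale1r.
elim: us hus => //= u us IH /all_unitary_cons[hu /IH{}IH] c hc.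
by apply/IH/convex_hull_half => //; exact: convex_hull_orbit_conj.
Qed.

End Basics.

(** * Complete norms, and unitaries near approximate unitaries *)

Section Limits.
Context {R : realType} {A : cstarType R}.
Implicit Types (a b c h u v w y z : A) (r s t d e : R).

(** The telescoping bound gives the rate of convergence, not only the limit. *)
Lemma geom_cvg (u : nat -> A) r :
  (forall n, cnorm (u n.+1 - u n) <= r * 2^-1 ^+ n.+1) ->
  exists l, forall n, cnorm (u n - l) <= r * 2^-1 ^+ n.
Proof.
move=> hu; have p0 n : 0 < 2^-1 ^+ n :> R by rewrite exprn_gt0// invr_gt0.
have r0 : 0 <= r by rewrite -(pmulr_lge0 r (p0 1)) (le_trans _ (hu 0))// cnorm_ge0.
have hk n k : cnorm (u (n + k)%N - u n) <= r * 2^-1 ^+ n - r * 2^-1 ^+ (n + k).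
  elim: k => [|k IH]; first by rewrite addn0 !subrr cnorm0.
  rewrite (le_trans (cnorm_triangle (u (n + k)%N) _ _))// addnS.
  rewrite (le_trans (lerD (hu _) IH))// !exprS; lra.
have hn n m : (n <= m)%N -> cnorm (u m - u n) <= r * 2^-1 ^+ n.
  move=> /subnKC <-; rewrite (le_trans (hk _ _))// gerBl mulr_ge0// ltW//.
have [|l hl] := @cnorm_complete R A u.
  move=> e e0; have [n0 hn0] := geom_small (2 * r) e0; exists n0 => m n hm hn'.
  apply: le_lt_trans hn0; rewrite (le_trans (cnorm_triangle (u n0) _ _))//.
  rewrite [X in _ + X]cnormB -mulrA mulr_natl mulr2n lerD ?hn//.
exists l => n; apply/ler_addgt0Pr => e e0; have [n0 h0] := hl _ e0.
rewrite (le_trans (cnorm_triangle (u (maxn n n0)) _ _))// lerD//.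
  by rewrite cnormB hn// leq_maxl.
by rewrite ltW// h0// leq_maxr.
Qed.

(** Newton's iteration for the unitary factor of the polar decomposition.  It
    needs neither a functional calculus nor an inverse, and it commutes with
    [star], so that u* u and u u* are controlled together. *)
Definition newton u : A := u + (2^-1)%:C *: (u * (1 - star u * u)).

Lemma star_newton u : star (newton u) = newton (star u).
Proof.
rewrite /newton starD starZr starM starB star1 starM starK.
by rewrite mulrBl mulrBr mul1r mulr1 mulrA.
Qed.

(** If 1 - u* u = 2 h, the new error is (1 - (1 + h) (1 - 2 h) (1 + h)) =
    h ^ 2 (3 + 2 h), quadratic in the old one. *)
Lemma newton_isometry_err u d : d <= 2^-1 -> cnorm (1 - star u * u) <= d ->
  cnorm (1 - star (newton u) * newton u) <= d / 2.
Proof.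
move=> d2; rewrite /newton; set e := 1 - star u * u => hd.
pose h := (2^-1)%:C *: e.
have d0 : 0 <= d by rewrite (le_trans _ hd)// cnorm_ge0.
have nh : cnorm h <= d / 2 by rewrite cnormZr ger0_norm ?invr_ge0// mulrC ler_pM2r// invr_gt0.
have hh : h + h = e by rewrite -scalerDr half_double.
have sh : star h = h by rewrite /h starZr /e starB star1 starM starK.
have -> : u + (2^-1)%:C *: (u * e) = u * (1 + h) by rewrite [RHS]mulrDr mulr1 scalerAr.
rewrite starM starD star1 sh !mulrA -(mulrA (1 + h)).
have -> : star u * u = 1 - (h + h) by rewrite hh /e opprB addrC subrK.
(* an identity in the commutative algebra generated by h, read off polynomials *)
have -> : 1 - (1 + h) * (1 - (h + h)) * (1 + h) = h * h * (3 + 2 * h).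
  have e1 : 1 - (1 + 'X) * (1 - ('X + 'X)) * (1 + 'X) =
      'X * 'X * (3 + 2 * 'X) :> {poly R[i]} by ring.
  have := congr1 (horner_alg h) e1.
  by rewrite !(rmorphB, rmorphM, rmorphD, rmorph1, rmorph_nat) /= horner_algX.
have n3 : cnorm (3 + 2 * h : A) <= 3 + d.
  rewrite (le_trans (cnormD _ _))// lerD//.
    by rewrite -scaler_nat -[3%:R](rmorph_nat (real_complex R)) cnormZr cnorm1 mulr1 ger0_norm.
  rewrite mulr_natl mulr2n (le_trans (cnormD _ _))//; lra.
have := cnorm_mul_le (cnorm_mul_le nh nh) n3 => /le_trans; apply; nra.
Qed.

Lemma cnorm_newton_sub u d : d <= 2^-1 -> cnorm (1 - star u * u) <= d ->
  cnorm u <= 2 /\ cnorm (newton u - u) <= d.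
Proof.
move=> d2 hd.
have u2 : cnorm u <= 2.
  rewrite -(@ler_pXn2r _ 2) ?nnegrE ?cnorm_ge0// -cnorm_star_mul.
  have -> : star u * u = 1 - (1 - star u * u) by rewrite opprB addrC subrK.
  by rewrite (le_trans (cnormD _ _))// cnormN cnorm1 expr2; lra.
split=> //; rewrite /newton addrAC subrr add0r cnormZr ger0_norm ?invr_ge0//.
have := cnorm_mul_le u2 hd; lra.
Qed.

Lemma limit_isometry (u : nat -> A) l r : (forall n, cnorm (u n) <= 2) ->
  (forall n, cnorm (1 - star (u n) * u n) <= r * 2^-1 ^+ n) ->
  (forall n, cnorm (u n - l) <= 2 * r * 2^-1 ^+ n) -> star l * l = 1.
Proof.
move=> u2 hu hl; apply/eqP; rewrite eq_sym -subr_eq0; apply/eqP/cnorm0_eq0/eqP.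
rewrite eq_le cnorm_ge0 andbT; apply: (@le0_geom _ _ ((2 * cnorm l + 5) * r)) => n.
have -> : 1 - star l * l =
    (1 - star (u n) * u n) + (star (u n - l) * u n + star l * (u n - l)).
  by rewrite starB mulrBl mulrBr addrA subrKA addrA subrK.
rewrite (le_trans (cnormD _ _))//.
have h1 : cnorm (star (u n - l) * u n) <= 2 * r * 2^-1 ^+ n * 2.
  by rewrite cnorm_mul_le ?cnorm_star.
have h2 : cnorm (star l * (u n - l)) <= cnorm l * (2 * r * 2^-1 ^+ n).
  by rewrite cnorm_mul_le ?cnorm_star.
have := cnormD (star (u n - l) * u n) (star l * (u n - l)).
have := hu n; nra.
Qed.

(** The errors of the iterates of [newton] halve at each step, and the iterates
    move by at most these errors, whose sum is at most 2 d. *)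
Lemma unitary_near u d : d <= 2^-1 ->
  cnorm (1 - star u * u) <= d -> cnorm (1 - u * star u) <= d ->
  exists2 v, unitaries v & cnorm (u - v) <= 2 * d.
Proof.
move=> d2 h1 h2; have d0 : 0 <= d by rewrite (le_trans _ h1)// cnorm_ge0.
pose w n := iter n newton u.
have dn n : d * 2^-1 ^+ n <= 2^-1.
  by rewrite (le_trans _ d2)// ler_piMr// exprn_ile1 ?invr_ge0 ?invf_le1 ?ler1n.
have isom_err v : cnorm (1 - star v * v) <= d ->
    forall n, cnorm (1 - star (iter n newton v) * iter n newton v) <= d * 2^-1 ^+ n.
  move=> hv; elim=> [|n IH]; first by rewrite expr0 mulr1.
  by rewrite iterS exprSr mulrA newton_isometry_err.
have starw n : star (w n) = iter n newton (star u).
  by elim: n => //= n IH; rewrite -IH star_newton.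
have hw1 n : cnorm (1 - star (w n) * w n) <= d * 2^-1 ^+ n by exact: isom_err.
have hw2 n : cnorm (1 - star (star (w n)) * star (w n)) <= d * 2^-1 ^+ n.
  by rewrite !starw; apply: isom_err; rewrite starK.
have [|l hl] := @geom_cvg w (2 * d).
  by move=> n; rewrite exprS; have [_] := cnorm_newton_sub (dn n) (hw1 n); rewrite /w /=; lra.
exists l; last by have := hl 0; rewrite expr0 mulr1.
split.
  by apply: (limit_isometry (u := w) _ hw1 hl) => n; case: (cnorm_newton_sub (dn n) (hw1 n)).
rewrite -{1}(starK l); apply: (limit_isometry (u := fun n => star (w n)) _ hw2) => n.
  by rewrite cnorm_star; case: (cnorm_newton_sub (dn n) (hw1 n)).
by rewrite -starB cnorm_star.
Qed.

End Limits.

(** * Minimal projections in a finite-dimensional C*-algebra *)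

Section Projections.
Context {R : realType} {A : cstarType R}.
Implicit Types (a b c e f h u v w x y z : A) (r s t d : R).

Lemma fd_dependent : finite_dimensional A ->
  exists n, forall v : 'I_n.+1 -> A,
    exists2 c : 'rV[R[i]]_n.+1, c != 0 & \sum_i c 0 i *: v i = 0.
Proof.
move=> [n [f [g fK gK]]]; exists n => v.
pose M := \matrix_(i < n.+1) g (v i).
have : kermx M != 0.
  rewrite -mxrank_eq0 mxrank_ker -lt0n subn_gt0 ltnS; exact: rank_leq_col.
move=> /rowV0Pn[c /sub_kermxP cM c0]; exists c => //.
have : f (c *m M) = 0 by rewrite cM linear0.
rewrite mulmx_sum_row linear_sum => f0; rewrite -[RHS]f0; apply: eq_bigr => i _.
by rewrite linearZ /= rowK gK.
Qed.

Lemma horner_alg_comm h z (p : {poly R[i]}) :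
  z * h = h * z -> z * horner_alg h p = horner_alg h p * z.
Proof.
move=> zh; elim/poly_ind: p => [|p c IH]; first by rewrite rmorph0 mulr0 mul0r.
rewrite rmorphD rmorphM /= horner_algX horner_algC mulrDr mulrDl.
by rewrite mulrA IH -!mulrA zh -scalerAr -scalerAl mul1r mulr1.
Qed.

Lemma horner_alg_eigen h y (k : R[i]) (p : {poly R[i]}) :
  h * y = k *: y -> horner_alg h p * y = p.[k] *: y.
Proof.
move=> hy; elim/poly_ind: p => [|p c IH]; first by rewrite rmorph0 horner0 mul0r scale0r.
rewrite rmorphD rmorphM /= horner_algX horner_algC mulrDl -mulrA hy -scalerAr IH.
by rewrite scalerA -scalerAl mul1r -scalerDl hornerMXaddC mulrC.
Qed.

Lemma fd_annihilator : finite_dimensional A ->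
  forall h, exists2 p : {poly R[i]}, p != 0 & horner_alg h p = 0.
Proof.
move=> /fd_dependent[n H] h; have [c c0 hc] := H (fun i => h ^+ i).
exists (rVpoly c).
  apply: contra c0 => /eqP c0; by rewrite -(rVpolyK c) c0 linear0.
rewrite -[RHS]hc [in LHS](row_sum_delta c) !linear_sum /=; apply: eq_bigr => i _.
by rewrite !linearZ /= rVpoly_delta rmorphXn /= horner_algX mulr_algl.
Qed.

(** A polynomial p with p(h) = 0 splits into linear factors.  Applying these
    successively to e, the last nonzero product is an eigenvector of h. *)
Lemma fd_eigenvector : finite_dimensional A ->
  forall h e, e != 0 -> exists (k : R[i]) (q : {poly R[i]}),
    horner_alg h q * e != 0 /\ h * (horner_alg h q * e) = k *: (horner_alg h q * e).
Proof.
move=> fd h e e0; have [p p0 hp] := fd_annihilator fd h.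
have [rs prs] := @closed_field_poly_normal (R[i]) p.
have : horner_alg h (\prod_(z <- rs) ('X - z%:P)) * e = 0.
  have l0 : lead_coef p != 0 by rewrite lead_coef_eq0.
  have : horner_alg h (lead_coef p *: \prod_(z <- rs) ('X - z%:P)) * e = 0.
    by rewrite -prs hp mul0r.
  rewrite linearZ /= mulr_algl -scalerAl => /eqP; rewrite scaler_eq0 (negbTE l0) /=.
  by move/eqP.
elim: rs e e0 {prs} => [|z rs IH] e e0.
  by rewrite big_nil rmorph1 mul1r => /eqP; rewrite (negbTE e0).
rewrite big_cons mulrC rmorphM /= -mulrA.
have [/eqP ye0 _|ye0 /(IH _ ye0)[k [q [h1 h2]]]] :=
    eqVneq (horner_alg h ('X - z%:P) * e) 0.
  exists z, 1; rewrite rmorph1 mul1r; split=> //; move: ye0.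
  by rewrite rmorphB /= horner_algX horner_algC mulrBl subr_eq0 -scalerAl mul1r => /eqP.
by exists k, (q * ('X - z%:P)); rewrite rmorphM /= -!mulrA.
Qed.

Lemma scalar_selfadjoint h e (k : R[i]) : star e = e -> e != 0 -> star h = h ->
  h = k *: e -> k = (complex.Re k)%:C.
Proof.
move=> se e0 sh hk; have : (k^*%R - k) *: e = 0.
  by rewrite scalerBl -{1}se -starZ -hk sh subrr.
move/eqP; rewrite scaler_eq0 (negbTE e0) orbF subr_eq0 => /eqP.
case: k {hk} => p q; move/eqP; rewrite eq_complex /= eqxx /= => /eqP qq.
have -> : q = 0 by lra.
by [].
Qed.

(** Spectral theorem in its smallest form: take y = q(h) e with h y = k y, as
    given by [fd_eigenvector].  Then y is normal and y y = q(k) y, so y* y is a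
    positive multiple of a projection f under e on which h acts as k.  Either
    f = e and h is a scalar multiple of e, or f splits e.  The last clause says
    that f lies in the double commutant of h and e. *)
Lemma projection_split : finite_dimensional A ->
  forall e h, star e = e -> e * e = e -> e != 0 -> star h = h -> h * e = h ->
  (exists r, h = r%:C *: e) \/
  exists f, [/\ star f = f, f * f = f, f != 0, f != e & f * e = f /\
     forall z, z * h = h * z -> z * e = e * z -> z * f = f * z].
Proof.
move=> fd e h se ee e0 sh he.
have eh : e * h = h by rewrite -[RHS]sh -[in RHS]he starM se sh.
have [k [q []]] := fd_eigenvector fd h e0.
set Q := horner_alg h q; set y := Q * e => y0 hy.
have eQ : e * Q = Q * e by apply: horner_alg_comm; rewrite he.
have ey : e * y = y by rewrite mulrA eQ -mulrA ee.
have yy : y * y = q.[k] *: y by rewrite {1}/y -mulrA ey (horner_alg_eigen _ hy).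
have hyC : h * y = y * h by rewrite /y mulrA (@horner_alg_comm h h)// -!mulrA eh he.
have hsyC : h * star y = star y * h by rewrite -{1}sh -starM -hyC starM sh.
have esy : e * star y = star y by rewrite starM se mulrA ee.
have sye : star y * e = star y by rewrite -[in RHS]ey [in RHS]starM se.
(* y* commutes with h and absorbs e on both sides, hence commutes with q(h) e *)
have normal_y : star y * y = y * star y.
  by rewrite {2 3}/y mulrA (@horner_alg_comm h) // -!mulrA sye esy.
pose w := star y * y.
have sw : star w = w by rewrite starM starK.
have w0 : w != 0 by apply: contra y0 => /eqP /star_mul_eq0 ->.
pose l := (q.[k])^*%R * q.[k].
have ww : w * w = l *: w.
  rewrite /w {1}normal_y mulrA -(mulrA y) -starM yy starZ.
  by rewrite -scalerAr -normal_y -scalerAl -mulrA yy -scalerAr scalerA.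
have l0 : l != 0.
  apply/eqP => l0; move: ww; rewrite l0 scale0r -{1}sw => /star_mul_eq0 /eqP.
  by rewrite (negbTE w0).
have lc : l^*%R = l by rewrite /l rmorphM /= conjCK mulrC.
have lVc : (l^-1)^*%R = l^-1 by rewrite fmorphV /= lc.
have hw : h * w = k *: w by rewrite mulrA hsyC -mulrA hy -scalerAr.
have [fe|fe] := eqVneq (l^-1 *: w) e.
  left; have hk : h = k *: e by rewrite -[LHS]he -fe -scalerAr hw !scalerA mulrC.
  by exists (complex.Re k); rewrite -(scalar_selfadjoint se e0 sh hk).
right; exists (l^-1 *: w); split=> //.
- by rewrite starZ lVc sw.
- by rewrite -scalerAl -scalerAr ww !scalerA -mulrA mulVf// mulr1.
- by rewrite scaler_eq0 invr_eq0 negb_or l0.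
split; first by rewrite -scalerAl /w -mulrA /y -mulrA ee.
move=> z zh ze; rewrite -scalerAr -scalerAl; congr (_ *: _).
have zy z' : z' * h = h * z' -> z' * e = e * z' -> z' * y = y * z'.
  by move=> zh' ze'; rewrite /y mulrA (horner_alg_comm _ zh') -!mulrA ze'.
have zsy : z * star y = star y * z.
  rewrite -{1}(starK z) -starM -zy ?starM ?starK//.
    by rewrite -{1}sh -starM -zh starM sh.
  by rewrite -{1}se -starM -ze starM se.
by rewrite /w [LHS]mulrA zsy -[LHS]mulrA (zy _ zh ze) [LHS]mulrA.
Qed.

Definition orth_family N (e : 'I_N -> A) :=
  [/\ forall i, star (e i) = e i,
      forall i j, e i * e j = if i == j then e i else 0,
      forall i, e i != 0 & \sum_i e i = 1].

(** Nonzero orthogonal projections are linearly independent. *)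
Lemma orth_family_bound : finite_dimensional A ->
  exists n, forall N (e : 'I_N -> A), orth_family e -> (N <= n)%N.
Proof.
move=> /fd_dependent[n H]; exists n => N e [_ eo e0 _].
rewrite leqNgt; apply/negP => nN.
have [c c0 hc] := H (fun i => e (widen_ord nN i)).
case/rV0Pn: c0 => k; apply/negP; rewrite negbK.
have := congr1 (fun x => e (widen_ord nN k) * x) hc; rewrite /= mulr0 mulr_sumr.
rewrite (bigD1 k)//= big1 => [|i ik]; last first.
  rewrite -scalerAr eo ifN ?scaler0//; apply: contra ik => /eqP[ki].
  by apply/eqP/val_inj.
by rewrite addr0 -scalerAr eo eqxx => /eqP; rewrite scaler_eq0 (negbTE (e0 _)) orbF.
Qed.

(** Replace e k by the two projections f and e k - f; the second one takes the
    new index [ord0]. *)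
Lemma orth_family_refine N (e : 'I_N -> A) k f : orth_family e ->
  star f = f -> f * f = f -> f != 0 -> f != e k -> f * e k = f ->
  exists2 e' : 'I_N.+1 -> A, orth_family e' &
    forall i, [\/ e' i = e k - f, e' i = f | exists j, e' i = e j].
Proof.
move=> [se eo e0 e1] sf ff f0 fek fe.
have ef : e k * f = f by rewrite -[RHS]sf -[in RHS]fe starM se sf.
pose g j := if j == k then f else e j.
pose e' (i : 'I_N.+1) := if unlift ord0 i is Some j then g j else e k - f.
have e'0 : e' ord0 = e k - f by rewrite /e' unlift_none.
have e'S j : e' (lift ord0 j) = g j by rewrite /e' liftK.
have sg j : star (g j) = g j by rewrite /g; case: ifP.
have ge j : g j * e k = if j == k then f else 0.
  by rewrite /g; case: ifP => // jk; rewrite eo jk.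
have gf j : g j * f = if j == k then f else 0.
  by rewrite -ef mulrA ge; case: ifP; rewrite ?ff ?mul0r ?ef.
have gg i j : g i * g j = if i == j then g i else 0.
  rewrite {2}/g; case: eqVneq => [->|jk].
    by rewrite gf; case: eqVneq => // ->; rewrite /g eqxx.
  rewrite /g; case: (eqVneq i k) => [->|ik]; last exact: eo.
  by rewrite eq_sym (negbTE jk) -fe -mulrA eo eq_sym (negbTE jk) mulr0.
have gh j : g j * (e k - f) = 0 by rewrite mulrBr ge gf; case: ifP; rewrite subrr.
have sh : star (e k - f) = e k - f by rewrite starB se sf.
exists e'; last first.
  move=> i; rewrite /e'; case: unliftP => [j _|_]; last by constructor 1.
  by rewrite /g; case: ifP => _; [constructor 2|constructor 3; exists j].
split.
- by move=> i; rewrite /e'; case: unliftP.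
- move=> i j; rewrite /e'; case: unliftP => [i'|] ->; case: unliftP => [j'|] ->.
  + by rewrite gg (inj_eq (@lift_inj _ _)).
  + by rewrite gh eq_sym (negbTE (neq_lift _ _)).
  + by rewrite (negbTE (neq_lift _ _)) -sh -sg -starM gh star0.
  + by rewrite eqxx mulrBl !mulrBr eo eqxx ef fe ff subrr subr0.
- move=> i; rewrite /e'; case: unliftP => [j _|_]; last by rewrite subr_eq0 eq_sym.
  by rewrite /g; case: ifP.
rewrite big_ord_recl e'0; under eq_bigr do rewrite e'S.
rewrite -e1 (bigD1 k)//= [in RHS](bigD1 k)//= /g eqxx addrA subrK; congr (_ + _).
by apply: eq_bigr => i /negbTE ->.
Qed.

(** Among the families of orthogonal projections of sum 1 that commute with a,
    take one of maximal cardinality.  By [projection_split], a self-adjoint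
    element of a corner e_i A e_i that commutes with a is a scalar, since
    otherwise the family could be refined.  This applies to a e_i, and then to
    every self-adjoint element of the corner, because a acts on it as a scalar. *)
Lemma diagonalization : finite_dimensional A ->
  forall a, star a = a -> exists N (e : 'I_N -> A) (x : 'I_N -> R),
  [/\ orth_family e, a = \sum_i (x i)%:C *: e i &
      forall i y, exists k : R[i], e i * y * e i = k *: e i].
Proof.
move=> fd a sa.
pose P N := `[< exists2 e : 'I_N -> A, orth_family e & forall i, a * e i = e i * a >].
have exP : exists N, P N.
  exists 1%N; apply/asboolP; exists (fun=> 1); last by move=> i; rewrite mulr1 mul1r.
  split=> [i|i j|i|]; rewrite ?star1 ?mulr1 ?oner_eq0//; last by rewrite big_ord1.
  by rewrite !ord1 eqxx.
have [n Pn] := orth_family_bound fd.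
have [N /asboolP[e he ae] Nmax] := ex_maxnP exP
  (fun N hN => let: ex_intro2 e he _ := asboolW hN in Pn N e he).
have [se eo e0 e1] := he.
have minimal k h : star h = h -> h * e k = h -> a * h = h * a -> exists r, h = r%:C *: e k.
  move=> sh hek ah; have ekk : e k * e k = e k by rewrite eo eqxx.
  have [//|[f [sf ff f0 fe [fek fC]]]] := projection_split fd (se k) ekk (e0 k) sh hek.
  have [e' he' e'P] := orth_family_refine he sf ff f0 fe fek.
  have : P N.+1.
    apply/asboolP; exists e' => // i; have af : a * f = f * a by apply: fC.
    by case: (e'P i) => [->|->|[j ->]] //; rewrite mulrBr mulrBl af ae.
  by move=> /Nmax; rewrite ltnn.
have /choice[x xP] : forall i, exists r, a * e i = r%:C *: e i.
  move=> i; apply: minimal; first by rewrite starM se sa ae.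
    by rewrite -mulrA eo eqxx.
  by rewrite -mulrA -ae.
exists N, e, x; split=> //.
  by rewrite -[LHS]mulr1 -e1 mulr_sumr; apply: eq_bigr.
have sc k y : star y = y -> exists r, e k * y * e k = r%:C *: e k.
  move=> sy; apply: minimal; first by rewrite !starM se sy mulrA.
    by rewrite -mulrA eo eqxx.
  rewrite !mulrA xP -[RHS]mulrA -ae xP.
  by rewrite -!scalerAl -!scalerAr.
move=> k y.
(* y = (y1 - 'i y2) / 2 with y1 and y2 self-adjoint *)
pose y1 := y + star y; pose y2 := 'i *: (y - star y).
have [|r hr] := sc k y1; first by rewrite starD starK addrC.
have [|s hs] := sc k y2.
  by rewrite /y2 starZ starB starK conjCi scaleNr -scalerN opprB.
exists ((2^-1)%:C * (r%:C - 'i * s%:C)).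
rewrite -scalerA scalerBl -hr -scalerA -hs -[in LHS](half_double y).
rewrite -!scalerAr -!scalerAl; congr (_ *: _).
rewrite scalerA -expr2 sqrCi scaleN1r opprK.
rewrite -mulrDl -mulrDr; congr (_ * _ * _).
by rewrite addrACA subrr addr0.
Qed.

End Projections.

(** * Averaging a diagonal element over a permutation *)

Section DiagonalElements.
Context {R : realType} {A : cstarType R}.
Implicit Types (a b c f g h u v w z : A) (r s t d : R).

Context (N : nat) (e : 'I_N -> A) (he : orth_family e).

Let se i : star (e i) = e i. Proof. by case: he. Qed.
Let eo i j : e i * e j = if i == j then e i else 0. Proof. by case: he. Qed.
Let e0 i : e i != 0. Proof. by case: he. Qed.
Let e1 : \sum_i e i = 1. Proof. by case: he. Qed.
Let ee i : e i * e i = e i. Proof. by rewrite eo eqxx. Qed.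

Let ne i : cnorm (e i) = 1.
Proof.
have := cnorm_star_mul (e i); rewrite se ee expr2 => h.
have n0 : cnorm (e i) != 0 by apply: contra (e0 i) => /eqP/cnorm0_eq0->.
by apply: (mulfI n0); rewrite mulr1 -h.
Qed.

Definition diag (x : 'I_N -> R) : A := \sum_i (x i)%:C *: e i.

Lemma star_diag x : star (diag x) = diag x.
Proof. by rewrite star_sum; apply: eq_bigr => i _; rewrite starZr se. Qed.

Lemma diag_mulr x i : diag x * e i = (x i)%:C *: e i.
Proof.
rewrite mulr_suml (bigD1 i)//= big1 => [|j /negbTE ji].
  by rewrite addr0 -scalerAl ee.
by rewrite -scalerAl eo ji scaler0.
Qed.

Lemma diag_mull x i : e i * diag x = (x i)%:C *: e i.
Proof. by rewrite -[LHS]starK starM star_diag se diag_mulr starZr se. Qed.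

Lemma diagM (x y : 'I_N -> R) : diag x * diag y = diag (fun i => x i * y i).
Proof.
rewrite mulr_sumr; apply: eq_bigr => i _.
by rewrite -scalerAr diag_mulr scalerA mulrC rmorphM.
Qed.

(** The triangle inequality gives the crude bound N d.  Applied to the power
    2 ^ n of [diag x], whose norm is that power of the norm of [diag x] by the
    C*-identity, it leaves a factor N that [le_pow2] removes. *)
Lemma cnorm_diag x d : 0 <= d -> (forall i, `|x i| <= d) -> cnorm (diag x) <= d.
Proof.
move=> d0 xd; apply: (@le_pow2 _ N%:R) => // n.
elim: n x d d0 xd => [|n IH] x d d0 xd.
  rewrite !expr1 (le_trans (cnorm_sum _ _ _))//.
  apply: (@le_trans _ _ (\sum_(i < N) d)); last by rewrite sumr_const card_ord mulr_natl.
  by apply: ler_sum => i _; rewrite cnormZr ne mulr1.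
rewrite expnS !exprM -cnorm_star_mul star_diag diagM; apply: IH.
  by rewrite exprn_ge0.
by move=> i; rewrite normrM expr2 ler_pM.
Qed.

Lemma le_cnorm_diag x i : `|x i| <= cnorm (diag x).
Proof.
have := cnormM (diag x) (e i); by rewrite diag_mulr cnormZr ne !mulr1.
Qed.

(** Murray-von Neumann equivalence of e i and e j.  When the e i are minimal
    projections, its classes correspond to the simple summands of the algebra. *)
Definition linked : rel 'I_N :=
  fun i j => `[< exists v, star v * v = e j /\ v * star v = e i >].

Lemma partial_isometry_supports v i j : star v * v = e j -> v * star v = e i ->
  v * e j = v /\ e i * v = v.
Proof.
move=> h1 h2; have h : v * e j = v.
  apply/eqP; rewrite -subr_eq0; apply/eqP/star_mul_eq0.
  by rewrite starB starM se mulrBl !mulrBr !mulrA h1 -(mulrA (e j)) h1 !ee !subrr.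
by rewrite -h2 -mulrA h1.
Qed.

Lemma linked_refl i : linked i i.
Proof. by apply/asboolP; exists (e i); rewrite se ee. Qed.

Lemma linked_sym i j : linked i j -> linked j i.
Proof. by move=> /asboolP[v [h1 h2]]; apply/asboolP; exists (star v); rewrite starK. Qed.

Lemma linked_trans j i k : linked i j -> linked j k -> linked i k.
Proof.
move=> /asboolP[v [v1 v2]] /asboolP[w [w1 w2]]; apply/asboolP; exists (v * w).
have [vj iv] := partial_isometry_supports v1 v2.
have [wk jw] := partial_isometry_supports w1 w2.
split; first by rewrite starM mulrA -(mulrA (star w)) v1 -mulrA jw.
by rewrite starM mulrA -(mulrA v) w2 vj.
Qed.

Lemma linked_equiv : equivalence_rel linked.
Proof.
move=> i j k; split; first exact: linked_refl.
move=> ij; apply/idP/idP; apply: linked_trans => //; exact: linked_sym.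
Qed.

Definition minimal_family := forall i y, exists k : R[i], e i * y * e i = k *: e i.

(** (h + g)* (h + g) = h h - g g, and a C*-norm detects zero on y* y. *)
Lemma selfadjoint_add_skew_eq0 h g : star h = h -> star g = - g ->
  g * h = h * g -> h * h = g * g -> h + g = 0.
Proof.
move=> sh sg gh hh; apply: star_mul_eq0; rewrite starD sh sg.
by rewrite mulrDl !mulrDr !mulNr hh gh -opprD [X in X - _]addrC subrr.
Qed.

(** If x = e_i y e_j is nonzero, then x* x = r e_j and x x* = r e_i for the same
    real r, by minimality.  If r > 0, then r ^ (-1/2) x is the partial isometry
    that links i and j.  If r < 0, then h = x + x* is self-adjoint with
    h h = r (e_i + e_j), the square of a skew-adjoint multiple of e_i + e_j, so
    that [selfadjoint_add_skew_eq0] gives a contradiction. *)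
Lemma unlinked_eq0 i j y : minimal_family -> ~~ linked i j -> e i * y * e j = 0.
Proof.
move=> emin; apply: contraNeq; set x := e i * y * e j => x0.
have [/eqP->|ij] := boolP (i == j); first exact: linked_refl.
have eij : e i * e j = 0 by rewrite eo (negbTE ij).
have eji : e j * e i = 0 by rewrite eo eq_sym (negbTE ij).
have xj : x * e j = x by rewrite /x -mulrA ee.
have ix : e i * x = x by rewrite /x !mulrA ee.
clearbody x.
have sxi : star x * e i = star x by rewrite -[in RHS]ix starM se.
have jsx : e j * star x = star x by rewrite -[in RHS]xj starM se.
have [k kP] : exists k : R[i], star x * x = k *: e j.
  by have [k kP] := emin j (star x * x); exists k; rewrite -kP !mulrA jsx -mulrA xj.
have [l lP] : exists l : R[i], x * star x = l *: e i.
  by have [l lP] := emin i (x * star x); exists l; rewrite -lP !mulrA ix -mulrA sxi.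
(* both scalars are read off x x* x *)
have kl : l = k.
  have : l *: x = k *: x.
    by rewrite -{1}ix scalerAl -lP -mulrA kP -scalerAr xj.
  move/eqP; rewrite -subr_eq0 -scalerBl scaler_eq0 (negbTE x0) orbF subr_eq0.
  by move/eqP.
have kr : k = (complex.Re k)%:C.
  by apply: (scalar_selfadjoint (se j) (e0 j) _ kP); rewrite starM starK.
move: kP lP; rewrite kl kr; move: (complex.Re k) => {kr kl k l} r kP lP.
have [r0|r0|r0] := ltgtP r 0; last 1 first.
- by move: kP; rewrite r0 scale0r => /star_mul_eq0 /eqP; rewrite (negbTE x0).
- pose s := Num.sqrt (- r).
  have s0 : s != 0 by rewrite sqrtr_eq0 -ltNge oppr_gt0.
  pose p := e i + e j; pose h := x + star x.
  have sp : star p = p by rewrite starD !se.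
  have sh : star h = h by rewrite starD starK addrC.
  have xi : x * e i = 0 by rewrite -xj -mulrA eji mulr0.
  have sxj : star x * e j = 0 by rewrite -sxi -mulrA eij mulr0.
  have xx : x * x = 0 by rewrite -{1}xj -{2}ix mulrA -(mulrA x) eji mulr0 mul0r.
  have pp : p * p = p by rewrite mulrDl !mulrDr !ee eij eji addr0 add0r.
  have hp : h * p = h by rewrite mulrDl !mulrDr xi xj sxi sxj addr0 add0r.
  have ph : p * h = h by rewrite -[RHS]sh -[in RHS]hp starM sp sh.
  have hh : h * h = r%:C *: p.
    rewrite mulrDl !mulrDr xx -starM xx star0 addr0 add0r lP kP -scalerDr //.
  pose g : A := ('i * s%:C) *: p.
  have sg : star g = - g by rewrite /g starZ rmorphM /= conjCi conj_real sp mulNr scaleNr.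
  have gh : g * h = h * g by rewrite /g -scalerAl -scalerAr ph hp.
  have gg : g * g = r%:C *: p.
    rewrite /g -scalerAl -scalerAr pp scalerA mulrACA -expr2 sqrCi -rmorphM -expr2.
    by rewrite sqr_sqrtr ?oppr_ge0 ?ltW// mulN1r rmorphN opprK.
  have hg0 : h + g = 0 by apply: selfadjoint_add_skew_eq0; rewrite ?hh ?gg.
  (* the corner of h at e i vanishes, that of g does not *)
  have := congr1 (fun z => e i * z * e i) hg0.
  rewrite /h /g mulr0 mul0r !mulrDr !mulrDl ix xi -mulrA sxi.
  have -> : e i * star x = 0 by rewrite -jsx mulrA eij mul0r.
  rewrite !add0r -scalerAr -scalerAl mulrDr mulrDl !ee -mulrA eji mulr0 addr0.
  move/eqP; rewrite scaler_eq0 (negbTE (e0 _)) orbF mulf_eq0 (negbTE (neq0Ci _)) /=.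
  by rewrite eq_complex /= (negbTE s0).
apply/asboolP; pose t := (Num.sqrt r)^-1.
have tt : t * t * r = 1.
  by rewrite -[X in _ * X](sqr_sqrtr (ltW r0)) -expr2 -exprMn mulVf ?expr1n// sqrtr_eq0 -ltNge.
exists (t%:C *: x); rewrite starZr; split.
  by rewrite -scalerAl -scalerAr kP !scalerA -!rmorphM tt scale1r.
by rewrite -scalerAl -scalerAr lP !scalerA -!rmorphM tt scale1r.
Qed.

(** Sum the partial isometries that carry e (s i) to e i. *)
Lemma unitary_permuting_diag (s : 'I_N -> 'I_N) : injective s ->
  (forall i, linked i (s i)) ->
  exists2 u, unitaries u & forall x, u * diag x * star u = diag (x \o s).
Proof.
move=> sinj hs.
have /choice[v vP] : forall i, exists v, star v * v = e (s i) /\ v * star v = e i.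
  by move=> i; exact/asboolP/hs.
have vs i : v i * e (s i) = v i by have [h1 h2] := vP i; case: (partial_isometry_supports h1 h2).
have ev i : e i * v i = v i by have [h1 h2] := vP i; case: (partial_isometry_supports h1 h2).
have sv i : star (v i) = star (v i) * e i by rewrite -{1}ev starM se.
have svs i : star (v i) = e (s i) * star (v i) by rewrite -{1}vs starM se.
pose u := \sum_i v i.
have su : star u = \sum_i star (v i) by exact: star_sum.
have vv (x : 'I_N -> R) : (\sum_i (x i)%:C *: v i) * star u = diag x.
  rewrite su mulr_suml; apply: eq_bigr => i _; rewrite mulr_sumr (bigD1 i)//=.
  rewrite big1 => [|j ji]; first by rewrite addr0 -scalerAl (vP i).2.
  rewrite -scalerAl -(vs i) (svs j) -mulrA (mulrA (e (s i))) eo inj_eq//.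
  by rewrite eq_sym (negbTE ji) mul0r mulr0 scaler0.
have ud x : u * diag x = \sum_i (x (s i))%:C *: v i.
  rewrite mulr_suml; apply: eq_bigr => i _.
  by rewrite -{1}vs -mulrA diag_mull -scalerAr vs.
have d1 : diag (fun=> 1) = 1.
  by rewrite -e1; apply: eq_bigr => i _; rewrite rmorph1 scale1r.
exists u; last by move=> x; rewrite ud vv.
split; last first.
  rewrite -d1 -vv; congr (_ * _); apply: eq_bigr => i _.
  by rewrite rmorph1 scale1r.
rewrite su mulr_suml -e1 [RHS](reindex_inj sinj); apply: eq_bigr => i _.
rewrite mulr_sumr (bigD1 i)//= big1 => [|j ji]; first by rewrite addr0 (vP i).1.
by rewrite -(ev j) (sv i) -mulrA (mulrA (e i)) eo eq_sym (negbTE ji) mul0r mulr0.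
Qed.

Definition osc_le (x : 'I_N -> R) d := forall i j, linked i j -> `|x i - x j| <= d.

(** The heart of the proof: one unitary, permuting the minimal projections so as
    to reverse the order of the eigenvalues in each class, halves the
    oscillation of the eigenvalues, whatever their number. *)
Lemma avg_halves_osc x d : osc_le x d ->
  exists u y, [/\ unitaries u, avg u (diag x) = diag y & osc_le y (d / 2)].
Proof.
move=> xd; have [s [sinj sl smono]] := order_reversing_perm x linked_equiv.
have [u hu uP] := unitary_permuting_diag sinj sl.
exists u, (fun i => 2^-1 * (x i + x (s i))); split=> //.
  rewrite /avg uP -big_split scaler_sumr; apply: eq_bigr => i _ /=.
  by rewrite -scalerDl scalerA -rmorphD -rmorphM.
move=> i j ij.
have sij : linked (s i) (s j).
  by apply: linked_trans (sl j); apply: linked_trans ij; apply: linked_sym.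
have := xd _ _ ij; have := xd _ _ sij; rewrite !ler_norml => /andP[h1 h2] /andP[h3 h4].
by apply/andP; case: (smono _ _ ij) => -[h5 h6]; split; lra.
Qed.

Lemma avgs_halve_osc n x d : osc_le x d ->
  exists us y, [/\ size us = n, all_unitary us, avgs us (diag x) = diag y &
                   osc_le y (d * 2^-1 ^+ n)].
Proof.
elim: n x d => [|n IH] x d xd; first by exists [::], x; rewrite expr0 mulr1.
have [u [y [hu uy yd]]] := avg_halves_osc xd.
have [us [z [sz hus usz zd]]] := IH _ _ yd.
exists (u :: us), z; split; first by rewrite /= sz.
- exact/all_unitary_cons.
- by rewrite /= uy.
- by rewrite exprS mulrA.
Qed.

(** Replacing each eigenvalue by that of a representative of its class gives a
    central element, since e_i y e_j = 0 between distinct classes. *)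
Lemma comm_le_diag x d : minimal_family -> 0 <= d -> osc_le x d ->
  comm_le (diag x) (2 * d).
Proof.
move=> emin d0 xd.
pose rep i := odflt i [pick j | linked i j].
have rl i : linked i (rep i) by rewrite /rep; case: pickP => [//|_]; exact: linked_refl.
have repE i j : linked i j -> rep i = rep j.
  move=> ij; have h : linked i =1 linked j by move=> k; case: (linked_equiv i j k) => _ ->.
  rewrite /rep (eq_pick h); case: pickP => // /(_ j); by rewrite linked_refl.
apply: (@comm_le_center _ _ _ _ (diag (x \o rep))).
  have dec z : z = \sum_i \sum_j e i * z * e j.
    rewrite -[LHS]mul1r -e1 mulr_suml; apply: eq_bigr => i _.
    by rewrite -mulr_sumr e1 mulr1.
  move=> y; rewrite [LHS]dec [RHS]dec; apply: eq_bigr => i _; apply: eq_bigr => j _.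
  rewrite !mulrA diag_mull -[RHS]mulrA diag_mulr -!scalerAl -!scalerAr /=.
  have [ij|ij] := boolP (linked i j); first by rewrite (repE _ _ ij).
  by rewrite unlinked_eq0// !scaler0.
have -> : diag x - diag (x \o rep) = diag (fun i => x i - x (rep i)).
  rewrite -sumrB; apply: eq_bigr => i _; by rewrite -scalerBl rmorphB.
by apply: cnorm_diag => // i; exact: xd.
Qed.

End DiagonalElements.

(** * Uniform averaging in finite dimension *)

Section FiniteDimensional.
Context {R : realType} {A : cstarType R}.
Context (fd : finite_dimensional A).
Implicit Types (a : A) (M : R).

Lemma fd_averaging_selfadjoint n a M : star a = a -> cnorm a <= M ->
  exists us, [/\ size us = n, all_unitary us &
    comm_le (avgs us a) (4 * M * 2^-1 ^+ n)].
Proof.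
move=> sa aM; have [N [e [x [he ax emin]]]] := diagonalization fd sa.
have M0 : 0 <= M by rewrite (le_trans _ aM)// cnorm_ge0.
have xM i : `|x i| <= M by rewrite (le_trans (le_cnorm_diag he x i))// /diag -ax.
have xo : osc_le e x (2 * M).
  move=> i j _; rewrite (le_trans (ler_normB _ _))//.
  by rewrite mulr_natl mulr2n lerD.
have [us [y [sz hus usy yo]]] := avgs_halve_osc he n xo.
exists us; split=> //; rewrite ax -/(diag e x) usy.
have -> : 4 * M * 2^-1 ^+ n = 2 * (2 * M * 2^-1 ^+ n) by rewrite !mulrA -natrM.
by apply: comm_le_diag => //; rewrite !mulr_ge0// exprn_ge0// invr_ge0.
Qed.

(** The bound depends on the number of unitaries and on M only, neither on the
    algebra nor on its dimension.  The self-adjoint and skew-adjoint parts are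
    treated one after the other: the second averaging does not spoil the bound
    reached for the first part, by [comm_le_avgs]. *)
Lemma fd_averaging n a M : cnorm a <= M ->
  exists us, [/\ size us = (n + n)%N, all_unitary us &
    comm_le (avgs us a) (8 * M * 2^-1 ^+ n)].
Proof.
move=> aM.
pose a1 := (2^-1)%:C *: (a + star a).
pose a2 := (2^-1)%:C *: ('i *: a + 'i *: (- star a)).
have sa1 : star a1 = a1 by rewrite /a1 starZr starD starK addrC.
have sa2 : star a2 = a2.
  by rewrite /a2 starZr starD !starZ starN starK conjCi !scaleNr !scalerN opprK addrC.
have ni : Normc.normc ('i%R : R[i]) = 1.
  by rewrite -complexiE /Normc.normc /= expr0n add0r expr1n sqrtr1.
have n1 : cnorm a1 <= M by apply: cnorm_half => //; rewrite cnorm_star.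
have n2 : cnorm a2 <= M.
  by apply: cnorm_half; rewrite cnormZ ni mul1r ?cnormN ?cnorm_star.
have aE : a = a1 + (- 'i) *: a2.
  rewrite /a2 -scalerDr scalerA mulrC -scalerA (scalerA (- 'i)) mulNr -expr2 sqrCi opprK scale1r.
  by rewrite -scalerDr addrACA subrr addr0 half_double.
have [us [sus hus cus]] := fd_averaging_selfadjoint n sa1 n1.
have n2' : cnorm (avgs us a2) <= M by rewrite (le_trans (cnorm_avgs _ hus)).
have [|vs [svs hvs cvs]] := fd_averaging_selfadjoint n _ n2'.
  by rewrite star_avgs sa2.
exists (us ++ vs); split; first by rewrite size_cat sus svs.
  exact: all_unitary_cat.
rewrite avgs_cat aE !avgsD !(avgsZ _ (- 'i%R)).
have := comm_leD (comm_le_avgs hvs cus) (comm_leZ (- 'i%R) cvs).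
by rewrite normcN ni mul1r => /comm_leW; apply; lra.
Qed.

End FiniteDimensional.

(** * The defect of centrality after m averages *)

Section Defect.
Context {R : realType} {A : cstarType R}.
Implicit Types (b c u v x : A) (r s t d : R).

(** The smallest commutator bound reachable from b by m averages over
    approximate unitaries of the unit ball, plus a penalty for their not being
    unitary: the quantifiers of a formula range over the whole unit ball.  The weight 4 of the
    penalty is the one that makes [defect_lt_avgs] lossless. *)
Fixpoint central_defect m b : R :=
  if m is m'.+1 then
    inf [set central_defect m' (avg u b) +
             4 * (cnorm (1 - star u * u) + cnorm (1 - u * star u))
        | u in @unit_ball R A]
  else sup [set cnorm (b * x - x * b) | x in @unit_ball R A].

Lemma unit_ball1 : unit_ball (1 : A).
Proof. by rewrite /unit_ball /= cnorm1. Qed.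

Lemma comm_le_defect0 b : comm_le b (central_defect 0 b).
Proof.
move=> x; have [x0|x0] := eqVneq (cnorm x) 0.
  by rewrite (cnorm0_eq0 _ x0) mulr0 mul0r subrr !cnorm0 mulr0.
have xp : 0 < cnorm x by rewrite lt_def x0 cnorm_ge0.
pose y := (cnorm x)^-1%:C *: x.
have y1 : cnorm y = 1 by rewrite cnormZr ger0_norm ?invr_ge0 ?cnorm_ge0// mulVf.
have : cnorm (b * y - y * b) <= central_defect 0 b.
  apply: ub_le_sup; last by exists y => //; rewrite /unit_ball /= y1.
  exists (2 * cnorm b) => _ [z z1 <-]; rewrite (le_trans (comm_le_cnorm b z))//.
  by rewrite ler_piMr// mulr_ge0// cnorm_ge0.
rewrite /y -scalerAr -scalerAl -scalerBr cnormZr ger0_norm ?invr_ge0 ?cnorm_ge0//.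
by rewrite mulrC ler_pdivrMr.
Qed.

Lemma defect0_le b d : 0 <= d -> comm_le b d -> central_defect 0 b <= d.
Proof.
move=> d0 bd; apply: ge_sup; first by exists (cnorm (b * 1 - 1 * b)), 1 => //; exact: unit_ball1.
by move=> _ [x x1 <-]; rewrite (le_trans (bd x))// ler_piMr.
Qed.

Lemma defect_ge0 m b : 0 <= central_defect m b.
Proof.
elim: m b => [|m IH] b.
  by have := comm_le_defect0 b 1; rewrite mulr1 mul1r subrr cnorm0 cnorm1 mulr1.
apply: lb_le_inf; first by eexists; exists 1; [exact: unit_ball1|].
by move=> _ [u _ <-]; rewrite addr_ge0// mulr_ge0// addr_ge0// cnorm_ge0.
Qed.

Lemma defectS_le m b u : cnorm u <= 1 -> central_defect m.+1 b <=
  central_defect m (avg u b) + 4 * (cnorm (1 - star u * u) + cnorm (1 - u * star u)).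
Proof.
move=> u1; apply: ge_inf; last by exists u.
by exists 0 => _ [v _ <-]; rewrite addr_ge0 ?defect_ge0// mulr_ge0// addr_ge0// cnorm_ge0.
Qed.

Lemma defectS_le_unitary m b u : unitaries u -> central_defect m.+1 b <= central_defect m (avg u b).
Proof.
move=> hu; have [u1 u2] := hu; have := @defectS_le m b u.
rewrite (cnorm_unitary hu) u1 u2 subrr cnorm0 addr0 mulr0 addr0.
exact.
Qed.

Lemma defect_le_cnorm m b : central_defect m b <= 2 * cnorm b.
Proof.
elim: m b => [|m IH] b.
  by apply: defect0_le; [rewrite mulr_ge0// cnorm_ge0|exact: comm_le_cnorm].
by rewrite (le_trans (defectS_le_unitary _ _ unitary1))// avg1.
Qed.

(** Averages over the unit ball are contractions, so the constant 2 of the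
    commutator with b persists. *)
Lemma defect_lipschitz m b c : central_defect m b <= central_defect m c + 2 * cnorm (b - c).
Proof.
elim: m b c => [|m IH] b c.
  apply: defect0_le; first by rewrite addr_ge0 ?defect_ge0// mulr_ge0// cnorm_ge0.
  have := comm_leD (comm_le_defect0 c) (comm_le_cnorm (b - c)).
  by rewrite addrC subrK.
rewrite -lerBlDr; apply: lb_le_inf; first by eexists; exists 1; [exact: unit_ball1|].
move=> _ [u u1 <-]; rewrite lerBlDr (le_trans (defectS_le m b u1))//.
have := IH (avg u b) (avg u c); have := cnorm_avg (b - c) u1.
rewrite avgB -/(central_defect m (avg u c)); lra.
Qed.

(** An approximate unitary u of error e lies within 2 e of a unitary v by
    [unitary_near].  Replacing u by v moves the average by 2 e at most, and the
    defect by 4 e at most, which the penalty pays for exactly. *)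
Lemma defect_lt_avgs m b t : t <= 1 -> cnorm b <= 1 -> central_defect m b < t ->
  exists2 us, all_unitary us & comm_le (avgs us b) t.
Proof.
move=> t1; elim: m b => [|m IH] b b1 bt.
  by exists [::] => //; exact: comm_leW (ltW bt) (comm_le_defect0 b).
have [|_ [u u1 <-]] := inf_lt _ bt.
- by eexists; exists 1; [exact: unit_ball1|].
rewrite -/(central_defect m (avg u b)); set p := cnorm _; set q := cnorm _; set e := p + q => ue.
have p0 : 0 <= p by exact: cnorm_ge0.
have q0 : 0 <= q by exact: cnorm_ge0.
have d0 := defect_ge0 m (avg u b).
have e2 : e <= 2^-1 by move: ue; rewrite /e; lra.
have [||v hv uv] := @unitary_near R A u e e2; rewrite -?/p -?/q.
- by rewrite lerDl.
- by rewrite lerDr.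
have v1 : cnorm v <= 1 by rewrite cnorm_unitary.
have [||us hus cus] := IH (avg v b).
- by rewrite (le_trans (cnorm_avg _ v1)).
- have := defect_lipschitz m (avg v b) (avg u b).
  have : cnorm (avg v b - avg u b) <= cnorm (v - u) * 1.
    by rewrite (le_trans (cnorm_avgB_unitary _ v1 u1))// ler_wpM2l// cnorm_ge0.
  rewrite (cnormB v); rewrite /e in ue uv *; lra.
by exists (v :: us) => //; exact/all_unitary_cons.
Qed.

End Defect.

(** * The defect as a formula *)

Section DefectFormula.
Context {R : realType}.

(** Weakening: p does not mention the bound variable [None]. *)
Fixpoint plift (V : Type) (p : starpoly R V) : starpoly R (option V) :=
  match p with
  | PVar v => PVar R (Some v)
  | POne => POne R (option V)
  | PScale c p => PScale c (plift p)
  | PAdd p q => PAdd (plift p) (plift q)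
  | PMul p q => PMul (plift p) (plift q)
  | PStar p => PStar (plift p)
  end.

Definition psub (V : Type) (p q : starpoly R V) := PAdd p (PScale (-1) q).

Definition penalized_sum (v : 'rV[R]_3) : R :=
  v ord0 (inord 0) + 4 * (v ord0 (inord 1) + v ord0 (inord 2)).

Lemma penalized_sum_continuous : continuous penalized_sum.
Proof.
move=> v; have h j : (fun w : 'rV[R]_3 => w ord0 j) @ v --> v ord0 j.
  exact: coord_continuous.
by apply: cvgD (h _) _; apply: cvgMr; exact: cvgD (h _) (h _).
Qed.

(** The element to be averaged is carried along as a polynomial p in the free
    variables, so that each average binds one more variable. *)
Fixpoint defect_formula m (V : Type) (p : starpoly R V) : formula R V :=
  let x : starpoly R (option V) := PVar R None in
  let q := plift p in
  let one := POne R (option V) in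
  if m is m'.+1 then
    FInf (FConn penalized_sum_continuous (fun i : 'I_3 =>
      match val i with
      | 0 => defect_formula m'
               (PScale (2^-1)%:C (PAdd q (PMul (PMul x q) (PStar x))))
      | 1 => FNorm (psub one (PMul (PStar x) x))
      | _ => FNorm (psub one (PMul x (PStar x)))
      end))
  else FSup (FNorm (psub (PMul q x) (PMul x q))).

Lemma peval_lift (A : cstarType R) (V : Type) (rho : V -> A) x (p : starpoly R V) :
  peval (assign rho x) (plift p) = peval rho p.
Proof. by elim: p => //= [c p ->|p -> q ->|p -> q ->|p ->]. Qed.

Lemma feval_defect (A : cstarType R) m (V : Type) (rho : V -> A) (p : starpoly R V) :
  feval rho (defect_formula m p) = central_defect m (peval rho p).
Proof.
elim: m V rho p => [|m IH] V rho p /=.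
  congr sup; apply: eq_imagel => x _.
  by rewrite peval_lift scaleN1r.
congr inf; apply: eq_imagel => u _.
rewrite /penalized_sum !mxE /= !inordK //= IH /= !peval_lift !scaleN1r.
by [].
Qed.

End DefectFormula.

(** * Transfer to an ultraproduct *)

Section Ultraproduct.
Context {R : realType} {J : Type} (V : set_system J) (UV : UltraFilter V).
Context (F : J -> cstarType R).

Lemma comm_le_upi (f : bfam F) t : 0 <= t -> (forall j, comm_le (f j) t) ->
  comm_le (upi UV f) t.
Proof.
move=> t0 ft x; apply/ler_addgt0Pr => e e0.
have t1 : 0 < t + 1 by lra.
have [|g xg gx] := @ultraproduct_lift R J V F UV x (cnorm x + e / (t + 1)).
  by rewrite ltrDl divr_gt0.
rewrite {1 2}xg !upiM upiB; apply: (@le_trans _ _ (t * (cnorm x + e / (t + 1)))).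
  by apply: ucnorm_le => j; apply: (le_trans (ft j _)); apply: ler_wpM2l => //; exact: gx.
rewrite mulrDr lerD2l mulrCA ler_piMr ?(ltW e0)// ler_pdivrMr//; lra.
Qed.

(** Averages of the same length m in all the factors, with a common bound, give
    an average of length m in the ultraproduct.  [fd_averaging] provides such
    averages because its bound is the same in all algebras. *)
Lemma defect_upi_le m t (f : bfam F) (us : forall j, seq (F j)) :
  0 <= t -> (forall j, size (us j) = m) -> (forall j, all_unitary (us j)) ->
  (forall j, comm_le (avgs (us j) (f j)) t) -> central_defect m (upi UV f) <= t.
Proof.
move=> t0; elim: m f us => [|m IH] f us sus hus cus.
  apply: defect0_le => //; apply: comm_le_upi => // j.
  by have := cus j; rewrite (size0nil (sus j)).
pose h j : F j := head 1 (us j).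
have usE j : us j = h j :: behead (us j) by rewrite /h; case: (us j) (sus j).
have hh j : unitaries (h j).
  by have := hus j; rewrite usE => /all_unitary_cons[].
have hb : exists M : R, forall j, cnorm (h j) <= M.
  by exists 1 => j; rewrite cnorm_unitary.
have sb : exists M : R, forall j, cnorm (avg (h j) (f j)) <= M.
  have [M fM] := bfamP f; exists M => j.
  by rewrite (le_trans (cnorm_avg _ _))// cnorm_unitary.
pose u := upi UV (BFam hb).
have hu : unitaries u.
  have uE (k : bfam F) : (forall j, k j = 1) -> upi UV k = 1.
    by move=> k1; rewrite (_ : k = bfam1 F)//; apply: bfam_eq => j; rewrite k1.
  split; rewrite [star u]ustarE /u !upiM; apply: uE => j.
    by have [] := hh j.
  by have [] := hh j.
apply: (le_trans (defectS_le_unitary _ _ hu)).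
have -> : avg u (upi UV f) = upi UV (BFam sb).
  rewrite /avg [star u]ustarE (upiM UV (BFam hb) f) !upiM upiD upiZ.
  by congr (upi UV _); apply: bfam_eq.
apply: (IH _ (fun j => behead (us j))) => [j|j v vus|j /=].
- by rewrite size_behead sus.
- by apply: hus; rewrite usE inE vus orbT.
- by have := cus j; rewrite usE.
Qed.

End Ultraproduct.

(** * Averaging in a pseudocompact C*-algebra, and the Dixmier property *)

Section Pseudocompact.
Context {R : realType} {A : cstarType R}.
Context (pcA : pseudocompact A).

(** The sentence sup_b (central_defect (n + n) b) is at most 16 / 2 ^ n in an
    ultraproduct of finite-dimensional algebras, hence also in A. *)
Lemma averaging_unit_ball (b : A) t : 0 < t -> t <= 1 -> cnorm b <= 1 ->
  exists2 us, all_unitary us & comm_le (avgs us b) t.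
Proof.
move=> t0 t1 b1; have [J [V [UV [F [fd AU]]]]] := pcA.
have [n hn] := geom_small 16 t0.
set s := 16 * _ in hn.
have s0 : 0 <= s by rewrite mulr_ge0// exprn_ge0// invr_ge0.
pose phi : sentence R := FSup (defect_formula (n + n) (PVar R None)).
have value (B : cstarType R) :
    sentence_value B phi = sup [set central_defect (n + n) x | x in @unit_ball R B].
  by congr sup; apply: eq_imagel => x _; exact: feval_defect.
have Us : sentence_value (ultraproduct F UV) phi <= s.
  rewrite value; apply: ge_sup; first by eexists; exists 1; [exact: unit_ball1|].
  move=> _ [x x1 <-].
  (* representatives are only bounded by r for r > 1, hence 16 = 8 * 2 above *)
  have [|f -> f2] := @ultraproduct_lift R J V F UV x 2.
    by rewrite (le_lt_trans x1)// ltr1n.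
  have H j : exists us, [/\ size us = (n + n)%N, all_unitary us &
      comm_le (avgs us (f j)) s].
    by have := fd_averaging (fd j) n (f2 j); rewrite -natrM.
  by apply: (@defect_upi_le _ _ _ _ _ _ _ _ (fun j => projT1 (cid (H j)))) => // j;
    case: (projT2 (cid (H j))).
apply: (@defect_lt_avgs R A (n + n)%N) => //.
apply: le_lt_trans hn; apply: le_trans Us; rewrite -AU value.
apply: ub_le_sup; last by exists b.
exists 2 => _ [x x1 <-]; rewrite (le_trans (defect_le_cnorm _ _))//.
by rewrite -[leRHS]mulr1 ler_wpM2l.
Qed.

(** The averages are linear, so it suffices to rescale b into the unit ball. *)
Lemma averaging (b : A) t : 0 < t ->
  exists2 us, all_unitary us & comm_le (avgs us b) t.
Proof.
move=> t0; have b0 := cnorm_ge0 b; pose M := cnorm b + 1 + t.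
have M0 : 0 < M by rewrite ltr_wpDl// addr_ge0// cnorm_ge0.
have bM : cnorm (M^-1%:C *: b) <= 1.
  rewrite cnormZr ger0_norm; last by rewrite invr_ge0 ltW.
  by rewrite ler_pdivrMl// mulr1 /M; lra.
have [||us hus cus] := @averaging_unit_ball (M^-1%:C *: b) (t / M) _ _ bM.
- by rewrite divr_gt0.
- by rewrite ler_pdivrMr// mul1r /M; lra.
exists us => //; have := comm_leZ M%:C cus.
rewrite avgsZ scalerA -rmorphM divff ?gt_eqF// scale1r normc_real gtr0_norm//.
by rewrite mulrC divfK// gt_eqF.
Qed.

End Pseudocompact.

Theorem proposition5p10 (R : realType) (A : cstarType R) (hA : pseudocompact A) :
  dixmier_property A.
Proof.
move=> a; pose p n : R := 2^-1 ^+ n.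
have p0 n : 0 < p n by rewrite exprn_gt0// invr_gt0.
have /choice[next nextP] : forall nc : nat * A, exists us,
    all_unitary us /\ comm_le (avgs us nc.2) (p nc.1).
  by move=> [n c]; have [us] := averaging hA c (p0 n); exists us.
(* b n averages b (n - 1) further, down to commutator bound 2 ^ (- n) *)
pose L := fix L n :=
  if n is n'.+1 then L n' ++ next (n, avgs (L n') a) else next (0%N, a).
pose b n := avgs (L n) a.
have hL n : all_unitary (L n).
  elim: n => [|n IH] /=; first by case: (nextP (0%N, a)).
  by apply: all_unitary_cat => //; case: (nextP (n.+1, avgs (L n) a)).
have hb n : comm_le (b n) (p n).
  case: n => [|n]; first by case: (nextP (0%N, a)).
  by rewrite /b /= avgs_cat; case: (nextP (n.+1, avgs (L n) a)).
have [|z hz] := @geom_cvg R A b 2.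
  move=> n; rewrite exprS mulrA divff// mul1r /b /= avgs_cat.
  by apply: cnorm_avgs_sub (hb n); case: (nextP (n.+1, avgs (L n) a)).
exists z; split.
  move=> e e0; have [n hn] := geom_small 2 e0.
  exists (b n); first exact: convex_hull_avgs.
  by rewrite cnormB (le_lt_trans (hz n)).
move=> x; apply/eqP; rewrite -subr_eq0; apply/eqP/cnorm0_eq0/eqP.
rewrite eq_le cnorm_ge0 andbT; apply: (@le0_geom _ _ (5 * cnorm x)) => n.
have zb := hz n; rewrite cnormB in zb.
have := comm_leD (hb n) (comm_le_cnorm (z - b n)) x.
have -> : b n + (z - b n) = z by rewrite addrC subrK.
move=> /le_trans; apply; have := cnorm_ge0 x; rewrite -/(p n) in zb *; nra.
Qed.
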